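(* Let $a\in(0,1)$, $n\ge 2$, and $P(z) = (z-a)\prod_{j=1}^{n-1}(z-z_j)$ with $|z_j| \leq 1$ for all $j = 1, \ldots , n-1$. Define $\gamma(a) = 0.1a+0.9$, $c = a\gamma(a)$, $p' = \frac{a/4}{1-a/2}$, $q' = \frac{a/4}{1+a/2}$, $r = \frac{c(a-c)}{2(1-c^2)}$, $\alpha = \frac{\log ( a/16 )}{\log \left( \frac{c+r}{1+cr} \right)}$, $$K' = \min \left\{ (1+c-ac)^{p'} \left(\sqrt{1+c^2-ac}\right)^{1-p'},\ (1+c)^{q'} \left(\sqrt{1+c^2-ac}\right)^{1-q'} \right\},$$ $\mathcal{N}_0(a) = \frac{32 \log ( 40/a^2 )}{a^2}$, $\mathcal{N}_1(a) = \max \left \{ 9 \left( \frac{4+2a}{a} \right)^2 , \mathcal{N}_0(a) \right \}$, $\mathcal{N}_2(a,c) = \max \left \{ 9 \left( \frac{\log ( a/16 )}{\log \left( \frac{c}{1+a} \right) } \right)^2 , \mathcal{N}_0(a) \right \}$, and $$\mathcal{N}_3(a) = \max\left\{\mathcal{N}_0(a),\ \frac{\log \left( \frac{1+a}{a-c} \right) + \log \left( \frac{1-ac}{1-c} \right) - \alpha \log(r)}{\log (K')} + 1\right\}.$$ If $n > \max \{ \mathcal{N}_1(a), \mathcal{N}_2(a, c), \mathcal{N}_3(a) \}$, then $P'$ has a zero in the closed disk $\{z : |z-a|\leq 1\}$. *)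

(* Defs.v *)
From Stdlib Require Import Reals List.
Import ListNotations.
Open Scope R_scope.

Record Cx : Type := mkC { Cre : R; Cim : R }.
Definition C0 : Cx := mkC 0 0.
Definition RtoC (x : R) : Cx := mkC x 0.
Definition Cadd (z w : Cx) : Cx := mkC (Cre z + Cre w) (Cim z + Cim w).
Definition Copp (z : Cx) : Cx := mkC (- Cre z) (- Cim z).
Definition Csub (z w : Cx) : Cx := Cadd z (Copp w).
Definition Cmul (z w : Cx) : Cx :=
  mkC (Cre z * Cre w - Cim z * Cim w) (Cre z * Cim w + Cim z * Cre w).
Definition Cmod (z : Cx) : R := sqrt (Cre z ^ 2 + Cim z ^ 2).

(* Polynomials over Cx: coefficient lists, lowest degree first. *)
Definition cpoly := list Cx.
Fixpoint padd (p q : cpoly) : cpoly :=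
  match p, q with
  | [], _ => q
  | _, [] => p
  | a :: p', b :: q' => Cadd a b :: padd p' q'
  end.
Definition pscale (c : Cx) (p : cpoly) : cpoly := map (Cmul c) p.
Fixpoint pmul (p q : cpoly) : cpoly :=
  match p with
  | [] => []
  | a :: p' => padd (pscale a q) (C0 :: pmul p' q)
  end.
Fixpoint peval (p : cpoly) (z : Cx) : Cx :=
  match p with
  | [] => C0
  | a :: p' => Cadd a (Cmul z (peval p' z))
  end.
Fixpoint pderiv_aux (k : nat) (p : cpoly) : cpoly :=
  match p with
  | [] => []
  | a :: p' => Cmul (RtoC (INR k)) a :: pderiv_aux (S k) p'
  end.
Definition pderiv (p : cpoly) : cpoly :=
  match p with [] => [] | _ :: p' => pderiv_aux 1 p' end.
Definition plin (w : Cx) : cpoly := [Copp w; mkC 1 0].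
Definition Ppoly (a : R) (zs : list Cx) : cpoly :=
  fold_right (fun w acc => pmul (plin w) acc) (plin (RtoC a)) zs.

Definition gamma_ (a : R) : R := a / 10 + 9 / 10.
Definition c_ (a : R) : R := a * gamma_ a.
Definition p'_ (a : R) : R := (a / 4) / (1 - a / 2).
Definition q'_ (a : R) : R := (a / 4) / (1 + a / 2).
Definition r_ (a : R) : R := let c := c_ a in c * (a - c) / (2 * (1 - c ^ 2)).
Definition alpha_ (a : R) : R :=
  let c := c_ a in let r := r_ a in ln (a / 16) / ln ((c + r) / (1 + c * r)).
Definition K'_ (a : R) : R :=
  let c := c_ a in
  Rmin (Rpower (1 + c - a * c) (p'_ a) * Rpower (sqrt (1 + c ^ 2 - a * c)) (1 - p'_ a))
       (Rpower (1 + c) (q'_ a) * Rpower (sqrt (1 + c ^ 2 - a * c)) (1 - q'_ a)).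
Definition N0 (a : R) : R := 32 * ln (40 / a ^ 2) / a ^ 2.
Definition N1 (a : R) : R := Rmax (9 * ((4 + 2 * a) / a) ^ 2) (N0 a).
Definition N2 (a c : R) : R := Rmax (9 * (ln (a / 16) / ln (c / (1 + a))) ^ 2) (N0 a).
Definition N3 (a : R) : R :=
  let c := c_ a in
  Rmax (N0 a)
    ((ln ((1 + a) / (a - c)) + ln ((1 - a * c) / (1 - c)) - alpha_ a * ln (r_ a))
       / ln (K'_ a) + 1).

(* Main.v *)
(* Suppose that no critical point of [P] lies in the closed disk of centre [a] and radius 1.
   By Gauss-Lucas every critical point [w] lies in the lens [|w| <= 1 < |w - a|], and there
   [|w - x|^2 <= (1 - x (a - x)) |w - a|^2] for [0 <= x <= a].  Writing
   [P(x) = - P'(a) \int_0^{a-x} \prod_w (1 + u / (w - a)) du], the Grace-Walsh-Szego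
   coincidence theorem replaces the [w]'s by a single point, which pins [|P(x)|] between
   multiples of [|P'(a)| / n] and shows that [P] does not vanish in a disk around each [x].

   At [x = a/4] the lower bound forces the mean of [Re z] over the zeros, hence that of [Re w]
   over the critical points, below [a/4].  Then [|P'|] is exponentially small compared with
   [|P'(a)|] on [[0, a/4]], so [|P(0)|] is comparable to [|P(a/4)|]; in particular
   [p := \prod |z|] is at least [1/4] and [|P(c)| <= 16 p / a].

   Now compare two estimates of [\prod_w |1 - c w|].  From below it is at least [K'^(n-1)],
   by concavity of the logarithm and the bound on the mean of [Re w].  From above, the
   logarithmic derivative of [P] at [1/c] bounds it by [(1-ac)/(1-c) \prod_z |1 - c z|].
   As no zero [z] is within pseudo-hyperbolic distance [r] of [c], a Harnack inequality
   compares [|c - z| / |1 - c z|] with a power of [|z|], and turns the latter product into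
   one controlled by [|P(c)|] and [p].  For [n > N3] the two estimates contradict each other. *)
Require Import Defs.
From Stdlib Require Import Reals List.
From Stdlib Require Lra.
From Coquelicot Require Hierarchy Derive AutoDerive.
From mathcomp Require all_boot all_order all_algebra.
From mathcomp Require complex polyrcf ring lra zify Rstruct.
Open Scope R_scope.

(** * Real analysis: inequalities for [ln] and [exp], and the constants of the statement *)

Module Analysis.
From Stdlib Require Import Lra.
From Coquelicot Require Import Hierarchy Derive AutoDerive.

Lemma ln_quotient x y : 0 < x -> 0 < y -> ln (x / y) = ln x - ln y.
Proof.
intros Hx Hy. unfold Rdiv.
rewrite ln_mult, ln_Rinv; [reflexivity | | | apply Rinv_0_lt_compat]; assumption.
Qed.

Lemma ln_le_sub1 x : 0 < x -> ln x <= x - 1.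
Proof.
intros Hx. assert (H := exp_ineq1_le (ln x)). rewrite exp_ln in H by assumption. lra.
Qed.

Lemma ln_le_div x y : 0 < x -> 0 < y -> ln x - ln y <= x / y - 1.
Proof.
intros Hx Hy. rewrite <- ln_quotient by assumption. apply ln_le_sub1.
now apply Rdiv_lt_0_compat.
Qed.

Lemma ln_ge x : 0 < x -> 1 - / x <= ln x.
Proof.
intros Hx. assert (H := ln_le_sub1 (/ x) (Rinv_0_lt_compat _ Hx)).
rewrite ln_Rinv in H by assumption. lra.
Qed.

Lemma ln_nondecreasing x y : 0 < x -> x <= y -> ln x <= ln y.
Proof.
intros Hx [H|H]; [left; now apply ln_increasing | subst; lra].
Qed.

(** The tangent to [ln] at the mean [w] lies above the graph at [u] and [v]; in the weighted sum of
    the two tangent inequalities the linear terms cancel. *)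
Lemma ln_concave u v t : 0 < u -> 0 < v -> 0 <= t <= 1 ->
  (1 - t) * ln u + t * ln v <= ln ((1 - t) * u + t * v).
Proof.
intros Hu Hv Ht. set (w := (1 - t) * u + t * v).
assert (Hw : 0 < w).
{ unfold w. destruct (Rle_lt_dec t (1 / 2)).
  - assert (0 < (1 - t) * u) by (apply Rmult_lt_0_compat; lra).
    assert (0 <= t * v) by (apply Rmult_le_pos; lra). lra.
  - assert (0 <= (1 - t) * u) by (apply Rmult_le_pos; lra).
    assert (0 < t * v) by (apply Rmult_lt_0_compat; lra). lra. }
assert (H1 := ln_le_div u w Hu Hw). assert (H2 := ln_le_div v w Hv Hw).
assert (H3 : (1 - t) * (ln u - ln w) <= (1 - t) * (u / w - 1)) by (apply Rmult_le_compat_l; lra).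
assert (H4 : t * (ln v - ln w) <= t * (v / w - 1)) by (apply Rmult_le_compat_l; lra).
assert (H5 : (1 - t) * (u / w - 1) + t * (v / w - 1) = 0).
{ replace ((1 - t) * (u / w - 1) + t * (v / w - 1)) with (w / w - 1).
  - field; lra.
  - unfold w at 1. field. lra. }
lra.
Qed.

(* [X] stands for [|1 - c w|] and [y] for [Re w]: [ln X] lies above the broken
   line through the values at [y = -1], [y = a - 1] and [y = a / 2], and a broken
   line with one kink lies above the flatter of its chords from [a / 2]. *)
Lemma ln_above_chord a c y X : 0 < a < 1 -> 0 < c < a -> -1 <= y <= a / 2 -> 0 < X ->
  1 - 2 * c * y + c ^ 2 * (1 - a ^ 2 + 2 * a * y) <= X ^ 2 -> 1 - c * y <= X ->
  let L0 := ln (sqrt (1 + c ^ 2 - a * c)) in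
  L0 + Rmin ((ln (1 + c - a * c) - L0) / (1 - a / 2)) ((ln (1 + c) - L0) / (1 + a / 2))
    * (a / 2 - y) <= ln X.
Proof.
intros Ha Hc Hy HX H1 H2 L0.
set (L1 := ln (1 + c - a * c)). set (L2 := ln (1 + c)).
set (sA := (L1 - L0) / (1 - a / 2)). set (sB := (L2 - L0) / (1 + a / 2)).
assert (B0 : 0 < 1 + c ^ 2 - a * c) by nra.
assert (B1 : 0 < 1 + c - a * c) by nra.
assert (EL0 : L0 = ln (1 + c ^ 2 - a * c) / 2).
{ unfold L0. assert (Hs := sqrt_lt_R0 _ B0).
  rewrite <- (sqrt_def (1 + c ^ 2 - a * c)) at 2 by lra.
  rewrite ln_mult by assumption. lra. }
assert (EA : L1 = L0 + sA * (1 - a / 2)) by (unfold sA; field; lra).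
assert (EB : L2 = L0 + sB * (1 + a / 2)) by (unfold sB; field; lra).
assert (Hmin : Rmin sA sB <= sA /\ Rmin sA sB <= sB) by (split; [apply Rmin_l|apply Rmin_r]).
destruct (Rle_lt_dec (a - 1) y) as [Hy1|Hy1].
(* To the right of the kink, concavity is applied to [X ^ 2], whose lower bound is affine in [y],
   with value [1 + c^2 - a c] at [y = a/2] and [(1 + c - a c)^2] at [y = a - 1]. *)
- assert (HA : L0 + sA * (a / 2 - y) <= ln X).
  { set (t := (a / 2 - y) / (1 - a / 2)).
    assert (Et : t * (1 - a / 2) = a / 2 - y) by (unfold t; field; lra).
    assert (Ht : 0 <= t <= 1) by nra.
    assert (HL := ln_concave (1 + c ^ 2 - a * c) ((1 + c - a * c) * (1 + c - a * c)) t B0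
      (Rmult_lt_0_compat _ _ B1 B1) Ht).
    rewrite ln_mult in HL by assumption. fold L1 in HL.
    assert (E : (1 - t) * (1 + c ^ 2 - a * c) + t * ((1 + c - a * c) * (1 + c - a * c))
      = 1 - 2 * c * y + c ^ 2 * (1 - a ^ 2 + 2 * a * y)).
    { replace y with (a / 2 - t * (1 - a / 2)) by lra. field. }
    rewrite E in HL.
    assert (HX2 : ln (X ^ 2) = 2 * ln X).
    { replace (X ^ 2) with (X * X) by ring. rewrite ln_mult by assumption. ring. }
    assert (HQ : 0 < 1 - 2 * c * y + c ^ 2 * (1 - a ^ 2 + 2 * a * y)).
    { rewrite <- E. assert (0 < (1 + c - a * c) * (1 + c - a * c)) by nra.
      destruct (Rle_lt_dec t (1/2)).
      - assert (0 < (1 - t) * (1 + c ^ 2 - a * c)) by (apply Rmult_lt_0_compat; lra).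
        assert (0 <= t * ((1 + c - a * c) * (1 + c - a * c))) by (apply Rmult_le_pos; lra). lra.
      - assert (0 <= (1 - t) * (1 + c ^ 2 - a * c)) by (apply Rmult_le_pos; lra).
        assert (0 < t * ((1 + c - a * c) * (1 + c - a * c))) by (apply Rmult_lt_0_compat; lra). lra. }
    assert (HM := ln_nondecreasing _ _ HQ H1).
    rewrite HX2 in HM.
    assert (Es : sA * (a / 2 - y) = t * (L1 - L0)) by (unfold sA, t; field; lra).
    rewrite Es. rewrite EL0 in *. nra. }
  assert (Rmin sA sB * (a / 2 - y) <= sA * (a / 2 - y)) by (apply Rmult_le_compat_r; lra).
  lra.
- set (t := (a - 1 - y) / a).
  assert (Et : t * a = a - 1 - y) by (unfold t; field; lra).
  assert (Ht : 0 <= t <= 1) by nra.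
  assert (HL := ln_concave (1 + c - a * c) (1 + c) t B1 ltac:(lra) Ht).
  assert (E : (1 - t) * (1 + c - a * c) + t * (1 + c) = 1 - c * y).
  { replace y with (a - 1 - t * a) by lra. ring. }
  rewrite E in HL. fold L1 L2 in HL.
  assert (HM := ln_nondecreasing (1 - c * y) X ltac:(nra) H2).
  (* To the left, [y] is a mean of [a - 1] and [-1], which are at distances [1 - a/2] and [1 + a/2]
     from [a/2]. *)
  assert (Ey : a / 2 - y = (1 - t) * (1 - a / 2) + t * (1 + a / 2)) by nra.
  rewrite Ey.
  assert (Rmin sA sB * (1 - a / 2) <= sA * (1 - a / 2)) by (apply Rmult_le_compat_r; lra).
  assert (Rmin sA sB * (1 + a / 2) <= sB * (1 + a / 2)) by (apply Rmult_le_compat_r; lra).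
  assert ((1 - t) * (Rmin sA sB * (1 - a / 2)) <= (1 - t) * (L1 - L0)) by (apply Rmult_le_compat_l; lra).
  assert (t * (Rmin sA sB * (1 + a / 2)) <= t * (L2 - L0)) by (apply Rmult_le_compat_l; lra).
  nra.
Qed.

(** * A Harnack inequality in pseudo-hyperbolic form *)

Section Harnack.
Variables c r : R.
Hypothesis Hc : 0 < c < 1.
Hypothesis Hr : 0 < r < 1.

(** [(c + s) / (1 + c s)] is the largest modulus of a point at pseudo-hyperbolic distance [s] from
    [c]; with this exponent the inequality of [harnack_le] is an equality at [s = r]. *)
Definition harnack_exp : R := ln r / ln ((c + r) / (1 + c * r)).

Lemma mobius_bounds s : 0 < s < 1 -> s < (c + s) / (1 + c * s) < 1.
Proof.
intros Hs. assert (0 < 1 + c * s) by nra.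
assert (0 < c * ((1 - s) * (1 + s))) by (repeat apply Rmult_lt_0_compat; lra).
assert (0 < (1 - c) * (1 - s)) by (apply Rmult_lt_0_compat; lra). split.
- apply (Rmult_lt_reg_r (1 + c * s)); [assumption|].
  replace ((c + s) / (1 + c * s) * (1 + c * s)) with (c + s) by (field; lra). nra.
- apply (Rmult_lt_reg_r (1 + c * s)); [assumption|].
  replace ((c + s) / (1 + c * s) * (1 + c * s)) with (c + s) by (field; lra). nra.
Qed.

(** In [final_contradiction] this makes [C (ln p - ln (a/16))] outweigh the single
    [ln p - ln (a/16)] that comes from the bound on [|P(c)|]. *)
Lemma harnack_exp_ge1 : 1 <= harnack_exp.
Proof.
destruct (mobius_bounds r Hr) as [H1 H2]. unfold harnack_exp.
assert (L1 := ln_increasing _ _ (proj1 Hr) H1).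
assert (L2 : ln ((c + r) / (1 + c * r)) < 0) by (rewrite <- ln_1; apply ln_increasing; lra).
replace (ln r / ln ((c + r) / (1 + c * r)))
  with ((- ln r) / (- ln ((c + r) / (1 + c * r)))) by (field; lra).
apply (Rmult_le_reg_r (- ln ((c + r) / (1 + c * r)))); [lra|].
replace (- ln r / - ln ((c + r) / (1 + c * r)) * - ln ((c + r) / (1 + c * r))) with (- ln r)
  by (field; lra). lra.
Qed.

(* The derivative in [s] has the sign of [c (s + 1/s) + const], which is decreasing on
   [(0, 1)]; so the difference, zero at both ends, cannot dip below zero. *)
Lemma harnack_le s : r <= s <= 1 ->
  harnack_exp * ln ((c + s) / (1 + c * s)) <= ln s.
Proof.
intros Hs. set (C := harnack_exp).
pose (F := fun s => ln s - C * (ln (c + s) - ln (1 + c * s))).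
pose (F' := fun s => / s - C * (/ (c + s) - c * / (1 + c * s))).
assert (HF : forall s, 0 < s -> F s = ln s - C * ln ((c + s) / (1 + c * s))).
{ intros x Hx. unfold F. assert (0 < c * x) by nra. rewrite ln_quotient by lra. reflexivity. }
assert (Fr : F r = 0).
{ rewrite HF by lra. unfold C, harnack_exp. destruct (mobius_bounds r Hr) as [H1 H2].
  assert (ln ((c + r) / (1 + c * r)) < 0) by (rewrite <- ln_1; apply ln_increasing; lra).
  field. lra. }
assert (F1 : F 1 = 0).
{ unfold F. replace (1 + c * 1) with (c + 1) by ring. rewrite ln_1. ring. }
assert (HD : forall x, 0 < x -> derivable_pt_lim F x (F' x)).
{ intros x Hx. apply is_derive_Reals. unfold F, F'. auto_derive.
  - repeat split; nra.
  - field. nra. }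
assert (sgn : forall x, 0 < x -> F' x * (x * (c + x) * (1 + c * x))
   = x * (c * (x + / x) + (1 + c ^ 2 - C * (1 - c ^ 2)))).
{ intros x Hx. unfold F'. field. nra. }
enough (HFs : 0 <= F s) by (rewrite HF in HFs by lra; lra).
destruct (Rle_lt_dec 0 (F s)) as [|Neg]; [assumption|exfalso].
assert (Hs1 : r < s) by (destruct (Rle_lt_or_eq_dec r s (proj1 Hs)); [assumption|subst; lra]).
assert (Hs2 : s < 1) by (destruct (Rle_lt_or_eq_dec s 1 (proj2 Hs)); [assumption|subst; lra]).
destruct (MVT_cor2 F F' r s Hs1) as [x1 [E1 [I1 I2]]]; [intros; apply HD; lra|].
destruct (MVT_cor2 F F' s 1 Hs2) as [x2 [E2 [J1 J2]]]; [intros; apply HD; lra|].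
assert (D1 : F' x1 < 0) by nra.
assert (D2 : 0 < F' x2) by nra.
set (k := 1 + c ^ 2 - C * (1 - c ^ 2)) in *.
assert (P1 : 0 < x1 * (c + x1) * (1 + c * x1)) by (repeat apply Rmult_lt_0_compat; nra).
assert (P2 : 0 < x2 * (c + x2) * (1 + c * x2)) by (repeat apply Rmult_lt_0_compat; nra).
assert (K1 : c * (x1 + / x1) + k < 0).
{ assert (H := sgn x1 ltac:(lra)). assert (F' x1 * (x1 * (c + x1) * (1 + c * x1)) < 0) by nra. nra. }
assert (K2 : 0 < c * (x2 + / x2) + k).
{ assert (H := sgn x2 ltac:(lra)). assert (0 < F' x2 * (x2 * (c + x2) * (1 + c * x2))) by nra. nra. }
assert (x1 + / x1 < x2 + / x2) by nra.
assert (E : x1 + / x1 - (x2 + / x2) = (x2 - x1) * (1 - x1 * x2) * / (x1 * x2)) by (field; lra).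
assert (0 < (x2 - x1) * (1 - x1 * x2) * / (x1 * x2)).
{ apply Rmult_lt_0_compat; [apply Rmult_lt_0_compat; nra|apply Rinv_0_lt_compat; nra]. }
lra.
Qed.
End Harnack.

(** * The constants [c], [r] and [K'] *)

Lemma c_bounds a : 0 < a < 1 ->
  9 / 10 * a <= c_ a /\ c_ a < a /\ a - c_ a = a * (1 - a) / 10.
Proof. intros Ha. unfold c_, gamma_. repeat split; nra. Qed.

Lemma r_bounds a : 0 < a < 1 ->
  0 < r_ a <= 1 / 2 /\ 2 * r_ a * (1 - c_ a ^ 2) = c_ a * (a - c_ a).
Proof.
intros Ha. destruct (c_bounds a Ha) as [H1 [H2 H3]].
unfold r_. set (c := c_ a) in *.
assert (Hc : 0 < 1 - c ^ 2) by nra.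
assert (E : 2 * (c * (a - c) / (2 * (1 - c ^ 2))) * (1 - c ^ 2) = c * (a - c)) by (field; lra).
set (r := c * (a - c) / (2 * (1 - c ^ 2))) in *.
assert (0 < c * (a - c)) by nra.
assert (c * (a - c) <= 1 - c ^ 2) by nra.
repeat split; nra.
Qed.

(** The logarithms of both entries of the minimum [K'] are the chords of [ln_above_chord] read off
    at [y = a/4]. They are positive because the loss [L0] is of order [c (a - c)], where
    [a - c = a (1 - a) / 10], which is less than what the slope gains over the length [a/4]. *)
Lemma ln_K' a : 0 < a < 1 ->
  let c := c_ a in let L0 := ln (sqrt (1 + c ^ 2 - a * c)) in
  let s := Rmin ((ln (1 + c - a * c) - L0) / (1 - a / 2)) ((ln (1 + c) - L0) / (1 + a / 2)) in
  0 < ln (K'_ a) <= L0 + s * (a / 4) /\ 0 <= s.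
Proof.
intros Ha c L0 s. destruct (c_bounds a Ha) as [H1 [H2 H3]]. fold c in H1, H2, H3.
set (L1 := ln (1 + c - a * c)) in *. set (L2 := ln (1 + c)) in *.
set (X := c * (a - c)).
assert (B0 : 0 < 1 - X) by (unfold X; nra).
assert (EX : 1 + c ^ 2 - a * c = 1 - X) by (unfold X; ring).
assert (EL0 : L0 = ln (1 - X) / 2).
{ unfold L0. rewrite EX. assert (Hs := sqrt_lt_R0 _ B0).
  rewrite <- (sqrt_def (1 - X)) at 2 by lra.
  rewrite ln_mult by assumption. lra. }
assert (HL0 : L0 <= 0) by (assert (H := ln_le_sub1 _ B0); unfold X in *; nra).
(* [X <= 1/10] gives [1 / (1 - X) <= 1 + 12/10 X], and the square root halves the coefficient. *)
assert (HL0' : - (X * (6 / 10)) <= L0).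
{ assert (H := ln_ge _ B0). assert (/ (1 - X) <= 1 + X * (12 / 10)).
  { apply (Rmult_le_reg_r (1 - X)); [assumption|]. rewrite Rinv_l by lra.
    assert (0 <= X <= 1 / 10) by (unfold X; nra). nra. }
  rewrite EL0. lra. }
assert (EX2 : X = a * c * (1 - a) / 10) by (unfold X; rewrite H3; field).
assert (Hca : 0 < c * (1 - a)) by (apply Rmult_lt_0_compat; lra).
assert (Hca' : c * (1 - a) <= 1 / 4).
{ assert (c * (1 - a) <= a * (1 - a)) by (apply Rmult_le_compat_r; lra).
  assert (Hsq := pow2_ge_0 (a - 1 / 2)). lra. }
assert (HL1 : 8 / 10 * (c * (1 - a)) <= L1).
{ unfold L1. replace (1 + c - a * c) with (1 + c * (1 - a)) by ring.
  set (h := c * (1 - a)) in *. assert (H := ln_ge (1 + h) ltac:(lra)).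
  assert (8 / 10 * h <= 1 - / (1 + h)).
  { apply (Rmult_le_reg_r (1 + h)); [lra|].
    replace ((1 - / (1 + h)) * (1 + h)) with h by (field; lra). nra. }
  lra. }
assert (HL2 : c / 2 <= L2).
{ unfold L2. assert (H := ln_ge (1 + c) ltac:(lra)).
  assert (c / 2 <= 1 - / (1 + c)).
  { apply (Rmult_le_reg_r (1 + c)); [lra|].
    replace ((1 - / (1 + c)) * (1 + c)) with c by (field; lra). nra. }
  lra. }
set (sA := (L1 - L0) / (1 - a / 2)) in *. set (sB := (L2 - L0) / (1 + a / 2)) in *.
assert (EA : sA * (1 - a / 2) = L1 - L0) by (unfold sA; field; lra).
assert (EB : sB * (1 + a / 2) = L2 - L0) by (unfold sB; field; lra).
assert (PA : 0 <= sA) by nra.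
assert (PB : 0 <= sB) by nra.
assert (VA : 0 < L0 + sA * (a / 4)).
{ assert ((L0 + sA * (a / 4)) * (1 - a / 2) = L0 * (1 - 3 * a / 4) + L1 * (a / 4)) by nra.
  assert (0 < L0 * (1 - 3 * a / 4) + L1 * (a / 4)).
  { assert (- (X * (6 / 10)) <= L0 * (1 - 3 * a / 4)) by nra.
    assert (8 / 10 * (c * (1 - a)) * (a / 4) <= L1 * (a / 4)) by (apply Rmult_le_compat_r; lra).
    assert (0 < a * (c * (1 - a))) by nra. rewrite EX2 in *. lra. }
  nra. }
assert (VB : 0 < L0 + sB * (a / 4)).
{ assert ((L0 + sB * (a / 4)) * (1 + a / 2) = L0 * (1 + a / 4) + L2 * (a / 4)) by nra.
  assert (0 < L0 * (1 + a / 4) + L2 * (a / 4)).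
  { assert (- (X * (6 / 10)) * (5 / 4) <= L0 * (1 + a / 4)) by nra.
    assert (c / 2 * (a / 4) <= L2 * (a / 4)) by (apply Rmult_le_compat_r; lra).
    assert (0 < a * c) by nra. assert (0 < a * (a * c)) by nra. rewrite EX2 in *. lra. }
  nra. }
assert (KA : ln (Rpower (1 + c - a * c) (p'_ a) * Rpower (sqrt (1 + c ^ 2 - a * c)) (1 - p'_ a))
   = L0 + sA * (a / 4)).
{ unfold Rpower at 1 2. rewrite <- exp_plus, ln_exp. fold L0 L1. unfold sA, p'_. field. lra. }
assert (KB : ln (Rpower (1 + c) (q'_ a) * Rpower (sqrt (1 + c ^ 2 - a * c)) (1 - q'_ a))
   = L0 + sB * (a / 4)).
{ unfold Rpower at 1 2. rewrite <- exp_plus, ln_exp. fold L0 L2. unfold sB, q'_. field. lra. }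
unfold K'_. cbv zeta. fold c.
set (ka := Rpower (1 + c - a * c) (p'_ a) * _) in *.
set (kb := Rpower (1 + c) (q'_ a) * _) in *.
assert (Pa : 0 < ka) by (apply Rmult_lt_0_compat; apply exp_pos).
assert (Pb : 0 < kb) by (apply Rmult_lt_0_compat; apply exp_pos).
split; [|apply Rmin_glb; assumption].
assert (Pm : 0 < Rmin ka kb) by (apply Rmin_glb_lt; assumption).
split.
- destruct (Rle_lt_dec ka kb).
  + rewrite Rmin_left by lra. lra.
  + rewrite Rmin_right by lra. lra.
- assert (M1 := ln_nondecreasing _ _ Pm (Rmin_l ka kb)).
  assert (M2 := ln_nondecreasing _ _ Pm (Rmin_r ka kb)).
  unfold s. destruct (Rle_lt_dec sA sB).
  + rewrite (Rmin_left sA sB), <- KA by assumption. exact M1.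
  + rewrite (Rmin_right sA sB), <- KB by (left; assumption). exact M2.
Qed.

Lemma exp_nondecreasing x y : x <= y -> exp x <= exp y.
Proof. intros [H|H]; [left; now apply exp_increasing | subst; lra]. Qed.

Lemma exp_pow x n : exp x ^ n = exp (INR n * x).
Proof.
induction n as [|n IH]; [now rewrite Rmult_0_l, exp_0|].
rewrite S_INR, Rmult_plus_distr_r, Rmult_1_l, exp_plus, <- IH. simpl. ring.
Qed.

(** A rational lower bound for numerical use: [exp x] is the fourth power of [exp (x / 4)]. *)
Lemma exp_ge_pow4 x : -4 <= x -> (1 + x / 4) ^ 4 <= exp x.
Proof.
intros Hx. replace x with (INR 4 * (x / 4)) at 2 by (simpl; field).
rewrite <- exp_pow. apply pow_incr. assert (H := exp_ineq1_le (x / 4)). lra.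
Qed.

(** * Numerical consequences of the largeness of the degree [N] *)

Section LargeDegree.
Variables (a N : R).
Hypothesis Ha : 0 < a < 1.
Hypothesis HN : N > Rmax (N1 a) (Rmax (N2 a (c_ a)) (N3 a)).

Lemma degree_ge : 144 <= N * a ^ 2.
Proof.
assert (H : 9 * ((4 + 2 * a) / a) ^ 2 < N).
{ eapply Rle_lt_trans; [|exact HN]. eapply Rle_trans; [|apply Rmax_l]. unfold N1. apply Rmax_l. }
assert (E : 9 * ((4 + 2 * a) / a) ^ 2 * a ^ 2 = 9 * (4 + 2 * a) ^ 2) by (field; lra).
assert (0 < a ^ 2) by nra. nra.
Qed.

Lemma degree_exp : exp (- (N * a ^ 2 / 32)) <= a ^ 2 / 40.
Proof.
assert (H : Defs.N0 a < N).
{ eapply Rle_lt_trans; [|exact HN]. eapply Rle_trans; [|apply Rmax_l]. unfold N1. apply Rmax_r. }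
assert (Ha2 : 0 < a ^ 2) by nra.
assert (E : Defs.N0 a * a ^ 2 = 32 * ln (40 / a ^ 2)) by (unfold Defs.N0; field; lra).
assert (P : 0 < a ^ 2 / 40) by lra.
rewrite <- (exp_ln (a ^ 2 / 40)) by assumption.
apply exp_nondecreasing.
replace (a ^ 2 / 40) with (/ (40 / a ^ 2)) by (field; lra).
rewrite ln_Rinv by (apply Rdiv_lt_0_compat; lra). nra.
Qed.

Lemma degree_N3 :
  ln ((1 + a) / (a - c_ a)) + ln ((1 - a * c_ a) / (1 - c_ a)) - alpha_ a * ln (r_ a)
    < (N - 1) * ln (K'_ a).
Proof.
assert (H : N3 a < N).
{ eapply Rle_lt_trans; [|exact HN]. eapply Rle_trans; [|apply Rmax_r]. apply Rmax_r. }
destruct (ln_K' a Ha) as [[K0 _] _].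
set (U := ln ((1 + a) / (a - c_ a)) + ln ((1 - a * c_ a) / (1 - c_ a)) - alpha_ a * ln (r_ a)).
assert (H2 : U / ln (K'_ a) + 1 < N) by (eapply Rle_lt_trans; [|exact H]; apply Rmax_r).
replace U with (U / ln (K'_ a) * ln (K'_ a)) by (field; lra).
apply Rmult_lt_compat_r; lra.
Qed.

(** [q] is the contraction factor [sqrt (1 - x (a - x))] at [x = a/4]; the inequality
    [1 - t <= exp (- t)] makes its powers decay exponentially. *)
Lemma geometric_small q n : INR n = N -> 0 <= q -> q ^ 2 = 1 - 3 * a ^ 2 / 16 -> q ^ n <= 1 / 100.
Proof.
intros En Hq Hq2. assert (HN2 := degree_ge).
assert (H1 : q <= exp (- (3 * a ^ 2 / 32))).
{ apply Rsqr_incr_0_var; [|left; apply exp_pos]. unfold Rsqr. rewrite <- exp_plus.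
  assert (H := exp_ineq1_le (- (3 * a ^ 2 / 32) + - (3 * a ^ 2 / 32))). nra. }
apply Rle_trans with (exp (- (3 * a ^ 2 / 32)) ^ n); [apply pow_incr; lra|].
rewrite exp_pow, En.
(* [N a^2 >= 144] makes the exponent [3 N a^2 / 32] at least [27/2]. *)
apply Rle_trans with (exp (- (27 / 2))); [apply exp_nondecreasing; nra|].
rewrite exp_Ropp. assert (H := exp_ge_pow4 (27 / 2) ltac:(lra)).
apply Rinv_le_contravar in H; [|lra]. eapply Rle_trans; [exact H|]. 
replace ((1 + 27 / 2 / 4) ^ 4) with (35 ^ 4 / 8 ^ 4) by field. lra.
Qed.

(* [p = \prod |a/4 - z|] and [S = \sum Re z] over the zeros other than [a];
   [Y = \sum Re w] over the critical points. *)
Lemma mean_small S Y p : p ^ 2 <= exp ((N - 1) * (a / 4) ^ 2 - 2 * (a / 4) * S) ->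
  49 / 100 <= p -> N * Y = (N - 1) * (a + S) -> Y <= (N - 1) * (a / 4).
Proof.
intros H1 H2 H3. assert (HN2 := degree_ge).
(* [exp (-2) <= 1/5 < (49/100)^2 <= p^2] excludes an exponent below [-2]. *)
assert (HL : -2 <= (N - 1) * (a / 4) ^ 2 - 2 * (a / 4) * S).
{ destruct (Rle_lt_dec (-2) ((N - 1) * (a / 4) ^ 2 - 2 * (a / 4) * S)) as [|l]; [assumption|].
  exfalso. apply exp_increasing in l.
  assert (exp (-2) <= 1 / 5).
  { replace (-2) with (Ropp 2) by lra. rewrite exp_Ropp. assert (H := exp_ge_pow4 2 ltac:(lra)).
    apply Rinv_le_contravar in H; [|lra]. lra. }
  nra. }
assert (HN1 : 1 < N) by nra.
(* [a + S] is the sum of [Re z] over all the zeros; by [N a^2 >= 144] the constant 2 of [HL] is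
   absorbed. *)
assert (a + S <= N * (a / 4)).
{ assert (2 * (a / 4) * (a + S) <= 2 * (a / 4) * (N * (a / 4))) by nra. nra. }
nra.
Qed.

(** Up to a factor [exp (a^2 / 16) <= 11/10], the exponential is the square of
    [e = exp (- N a^2 / 32)]: one copy is at most [a^2 / 40] by [degree_exp], the other cancels the
    growth of [N a^2]. The constants close up as [36/5 / 40 = 9/50] and [9/50 * 11/10 < 1/5]. *)
Lemma decay_small : N * exp (- ((N - 1) * a ^ 2 / 16)) <= 1 / 5.
Proof.
assert (HN2 := degree_ge). assert (HE := degree_exp).
assert (Ha2 : 0 < a ^ 2 < 1) by nra.
assert (HN1 : 0 < N) by nra.
replace (- ((N - 1) * a ^ 2 / 16)) with (a ^ 2 / 16 + (- (N * a ^ 2 / 32) + - (N * a ^ 2 / 32))) by field.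
rewrite !exp_plus. set (e := exp (- (N * a ^ 2 / 32))) in *.
assert (e0 : 0 < e) by apply exp_pos.
assert (H1 : exp (a ^ 2 / 16) <= 11 / 10).
{ assert (H := exp_ineq1_le (- (a ^ 2 / 16))). rewrite exp_Ropp in H.
  assert (P := exp_pos (a ^ 2 / 16)).
  apply Rmult_le_compat_r with (r := exp (a ^ 2 / 16)) in H; [|lra].
  rewrite Rinv_l in H by lra. nra. }
assert (H2 : N * a ^ 2 * e <= 36 / 5).
{ assert (H := exp_ge_pow4 (N * a ^ 2 / 32) ltac:(lra)).
  assert (Ee : e * exp (N * a ^ 2 / 32) = 1).
  { unfold e. rewrite <- exp_plus. rewrite Rplus_opp_l. apply exp_0. }
  set (u := N * a ^ 2) in *.
  (* Nearly sharp at the endpoint [u = 144], where the right-hand side is about 146.8. *)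
  assert (u <= 36 / 5 * (1 + u / 32 / 4) ^ 4).
  { set (v := u / 128). replace (u / 32 / 4) with v by (unfold v; field).
    replace u with (128 * v) by (unfold v; field).
    assert (9 / 8 <= v) by (unfold v; lra).
    replace ((1 + v) ^ 4) with (((1 + v) ^ 2) ^ 2) by ring.
    assert ((17 / 8 + (v - 9/8)) ^ 2 >= 17 / 8 * (17 / 8 + 2 * (v - 9 / 8))) by nra.
    assert (0 <= 17 / 8 * (17 / 8 + 2 * (v - 9 / 8))) by nra.
    assert ((1 + v) ^ 2 >= 17 / 8 * (17 / 8 + 2 * (v - 9 / 8))) by nra.
    nra. }
  assert (e * (36 / 5 * (1 + u / 32 / 4) ^ 4) <= 36 / 5) by nra.
  nra. }
assert (H3 : N * (e * e) <= 9 / 50).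
{ assert (N * e * e <= N * e * (a ^ 2 / 40)) by (apply Rmult_le_compat_l; nra). nra. }
assert (0 < N * (e * e)) by (repeat apply Rmult_lt_0_compat; assumption).
nra.
Qed.
End LargeDegree.

(* [N] is the degree, [d = |P'(a)|], [k = |P(a/4)|], [p = \prod |z|] (so that
   [|P(0)| = a p]) and [v = |P(c)|]. *)
Lemma value_bounds a N d k p v E : 0 < a < 1 -> 0 < N -> N <= d -> 0 <= k ->
  37 / 100 * (a * d) <= k * N -> k - a * p <= a / 4 * (d * E) -> N * E <= 1 / 5 ->
  v * (N * c_ a) <= d * 4 ->
  1 / 4 <= p /\ v <= 16 * p / a.
Proof.
intros Ha HN Hd Hk H1 H2 H3 H4. destruct (c_bounds a Ha) as [C1 [C2 _]].
set (c := c_ a) in *.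
(* For [E > 0] the loss [a/4 * (d E)] is at most [k/4 * 100/37 * 1/5], less than [14/100 k]. *)
assert (Hp : 86 / 100 * k <= a * p).
{ destruct (Rle_lt_dec E 0).
  - assert (d * E <= 0) by nra. nra.
  - assert (37 / 100 * (a * d * E) <= k * (N * E)).
    { assert (37 / 100 * (a * d) * E <= k * N * E) by (apply Rmult_le_compat_r; lra). lra. }
    assert (k * (N * E) <= k * (1 / 5)) by (apply Rmult_le_compat_l; lra). lra. }
assert (Hk1 : 37 / 100 * a <= k).
{ apply (Rmult_le_reg_r N); [assumption|].
  assert (a * N <= a * d) by (apply Rmult_le_compat_l; lra). lra. }
split.
- apply (Rmult_le_reg_l a); lra.
(* With [a p >= 86/100 k] and [c >= 9/10 a], the bound comes down to
   [400/37 * 100/86 < 16 * 9/10]. *)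
- assert (G : v * (N * (a * c)) <= 4 * (100 / 37) * (k * N)).
  { assert (v * (N * c) * a <= d * 4 * a) by (apply Rmult_le_compat_r; lra). lra. }
  assert (G2 : v * (a * c) <= 400 / 37 * k).
  { apply (Rmult_le_reg_r N); [assumption|]. lra. }
  apply (Rmult_le_reg_r (a * c)); [nra|].
  apply Rle_trans with (400 / 37 * k); [assumption|].
  replace (16 * p / a * (a * c)) with (16 * p * c) by (field; lra).
  assert (0 < p) by nra.
  assert (16 * p * (9 / 10 * a) <= 16 * p * c) by (apply Rmult_le_compat_l; lra).
  lra.
Qed.

(* Notation of [value_bounds], with [s1 = \sum ln |1 - c z|]. *)
Lemma final_contradiction a N p v s1 : 0 < a < 1 ->
  N > Rmax (N1 a) (Rmax (N2 a (c_ a)) (N3 a)) ->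
  1 / 4 <= p -> 0 < v -> v <= 16 * p / a ->
  s1 <= ln (v / (a - c_ a)) - harnack_exp (c_ a) (r_ a) * ln p ->
  (N - 1) * ln (K'_ a) <= ln ((1 - a * c_ a) / (1 - c_ a)) + s1 -> False.
Proof.
intros Ha HN Hp Hv Hvp H1 H2.
assert (H3 := degree_N3 a N Ha HN).
destruct (c_bounds a Ha) as [C1 [C2 C3]]. destruct (r_bounds a Ha) as [R1 R2].
assert (HC := harnack_exp_ge1 (c_ a) (r_ a) ltac:(lra) ltac:(lra)).
set (C := harnack_exp (c_ a) (r_ a)) in *.
(* [alpha_] and [harnack_exp] have the same denominator, so the numerators can be exchanged. *)
assert (EA : alpha_ a * ln (r_ a) = C * ln (a / 16)).
{ unfold alpha_, C, harnack_exp. unfold Rdiv. ring. }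
rewrite EA in H3.
assert (Hac : 0 < a - c_ a) by lra.
rewrite ln_quotient in H1 by assumption. rewrite ln_quotient in H3 by lra.
assert (L1 : ln (a / 16) <= ln p) by (apply ln_nondecreasing; lra).
assert (L2 : ln v <= ln (1 + a) + (ln p - ln (a / 16))).
{ rewrite <- ln_quotient by lra. rewrite <- ln_mult; [|lra|apply Rdiv_lt_0_compat; lra].
  apply ln_nondecreasing; [assumption|].
  replace (p / (a / 16)) with (16 * p / a) by (field; lra).
  assert (0 < 16 * p / a) by (apply Rdiv_lt_0_compat; lra). nra. }
assert (1 * (ln p - ln (a / 16)) <= C * (ln p - ln (a / 16))) by (apply Rmult_le_compat_r; lra).
lra.
Qed.
End Analysis.

Module ComplexPoly.
From mathcomp Require Import all_boot all_order all_algebra.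
From mathcomp Require Import complex polyrcf ring lra zify.
Set Implicit Arguments.
Unset Strict Implicit.
Unset Printing Implicit Defensive.
Import Order.TTheory GRing.Theory Num.Theory.
Import ComplexField.Normc.
Local Open Scope ring_scope.
Local Open Scope complex_scope.

(** * Complex modulus and Laguerre's theorem on polar derivatives *)

Section Complex.
Variable R : rcfType.
Implicit Types (z w u : R[i]) (zs ws : seq R[i]).

Lemma normc_ge0 z : 0 <= normc z.
Proof. by case: z => x y; apply: sqrtr_ge0. Qed.

Lemma sqr_normcE z : normc z ^+ 2 = complex.Re z ^+ 2 + complex.Im z ^+ 2.
Proof. by case: z => x y /=; rewrite sqr_sqrtr // addr_ge0 ?sqr_ge0. Qed.

Lemma normc_eq0 z : (normc z == 0) = (z == 0).
Proof. by apply/eqP/eqP => [/eq0_normc|->]; rewrite ?normc0. Qed.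

Lemma normc_gt0 z : (0 < normc z) = (z != 0).
Proof. by rewrite lt_neqAle normc_ge0 andbT eq_sym normc_eq0. Qed.

Lemma normc_prod zs (F : R[i] -> R[i]) :
  normc (\prod_(z <- zs) F z) = \prod_(z <- zs) normc (F z).
Proof. by elim: zs => [|z zs IH]; rewrite ?big_nil ?normc1 // !big_cons normcM IH. Qed.

Lemma normcX z n : normc (z ^+ n) = normc z ^+ n.
Proof. by elim: n => [|n IH]; rewrite ?expr0 ?normc1 // !exprS normcM IH. Qed.

Lemma normcR (x : R) : normc x%:C = `|x|.
Proof. by rewrite /= expr0n /= addr0 sqrtr_sqr. Qed.

Lemma normc_sub z w : normc (z - w) = normc (w - z).
Proof. by rewrite -normcN opprB. Qed.

Lemma normc_nat n : normc (n%:R : R[i]) = n%:R.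
Proof. by rewrite -(rmorph_nat (real_complex R)) normcR ger0_norm ?ler0n. Qed.

Lemma ReD z w : complex.Re (z + w) = complex.Re z + complex.Re w.
Proof. by case: z; case: w. Qed.

Lemma Re_sum zs (F : R[i] -> R[i]) :
  complex.Re (\sum_(z <- zs) F z) = \sum_(z <- zs) complex.Re (F z).
Proof. by elim: zs => [|z zs IH]; rewrite ?big_nil // !big_cons ReD IH. Qed.

Lemma deriv_prod_XsubC_horner zs z : z \notin zs ->
  (\prod_(w <- zs) ('X - w%:P))^`().[z] =
  (\prod_(w <- zs) (z - w)) * \sum_(w <- zs) (z - w)^-1.
Proof.
elim: zs => [|w zs IH]; first by rewrite !big_nil derivC horner0 mulr0.
rewrite inE negb_or => /andP[zw /IH {}IH].
rewrite !big_cons derivM hornerD !hornerM derivXsubC hornerE IH !hornerE.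
have zw0 : z - w != 0 by rewrite subr_eq0.
rewrite horner_prod; under eq_bigr do rewrite !hornerE.
by rewrite mulrDr mulrAC divff // mul1r.
Qed.

(* [H u > 0] says that [z - u^-1] lies outside the disk; [H] is concave and
   positive at [0], the image of infinity, so the mean of the
   [(z - r)^-1] over the roots [r] cannot equal [(z - w)^-1]. *)
Lemma laguerre (p : {poly R[i]}) (m : nat) (z0 : R[i]) (q : R) z w :
  (size p <= m.+1)%N -> (0 < m)%N -> 0 <= q ->
  (forall t, normc (t - z0) <= q -> p.[t] != 0) ->
  normc (z - z0) <= q -> normc (w - z0) <= q ->
  p.[z] *+ m - (z - w) * p^`().[z] != 0.
Proof.
move=> sp m0 q0 pn0 zq wq; apply/eqP => E.
have pz0 := pn0 z zq.
have [rs prs] := closed_field_poly_normal p.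
have lp0 : lead_coef p != 0.
  by apply: contraNneq pz0 => l0; rewrite prs l0 scale0r horner0.
have srs : (size rs <= m)%N.
  by move: sp; rewrite prs size_scale // size_prod_XsubC.
have rsn r : r \in rs -> q < normc (r - z0).
  move=> rin; rewrite ltNge; apply/negP => /pn0 /negP; apply.
  by rewrite prs hornerZ mulf_eq0 -rootE root_prod_XsubC rin orbT.
have znr : z \notin rs.
  by apply/negP => /rsn; rewrite ltNge zq.
have pzE : p.[z] = lead_coef p * \prod_(r <- rs) (z - r).
  rewrite {1}prs hornerZ horner_prod; congr (_ * _).
  by apply: eq_bigr => r _; rewrite !hornerE.
have dzE : p^`().[z] = p.[z] * \sum_(r <- rs) (z - r)^-1.
  by rewrite {1}prs derivZ hornerZ deriv_prod_XsubC_horner // pzE mulrA.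
have zw0 : z - w != 0.
  apply: contra_eq_neq E => ->; rewrite mul0r subr0.
  by rewrite -mulr_natr mulf_neq0 // pnatr_eq0 -lt0n.
pose U := (z - w)^-1; pose v := z - z0; pose k := q ^+ 2 - normc v ^+ 2.
have sumE : \sum_(r <- rs) (z - r)^-1 = U *+ m.
  apply: (mulfI zw0); rewrite mulrnAr divff //.
  apply: (mulfI pz0); rewrite mulrCA -dzE mulr_natr.
  by apply/esym/eqP; rewrite -subr_eq0 E.
have k0 : 0 <= k by rewrite subr_ge0 ler_sqr ?nnegrE ?normc_ge0.
pose H u := 1 - 2 * complex.Re (v * u) - k * normc u ^+ 2.
have HE u : u != 0 -> H u = normc u ^+ 2 * (normc (z - u^-1 - z0) ^+ 2 - q ^+ 2).
  move=> u0; rewrite mulrBr -exprMn -normcM.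
  have -> : u * (z - u^-1 - z0) = v * u - 1.
    by rewrite /v !mulrBr divff // mulrBl; ring.
  rewrite /H /k; case: (v) => v1 v2; case: (u) => u1 u2.
  by rewrite !sqr_normcE /=; ring.
have HU : H U <= 0.
  rewrite HE ?invr_neq0 // /U invrK opprB addrCA subrr addr0.
  rewrite mulr_ge0_le0 ?sqr_ge0 // subr_le0 ler_sqr ?nnegrE ?normc_ge0 //.
(* [A + B] is the tangent at [U] to the concave function [H]; [B] is additive and so passes through
   the sum over the roots. *)
pose B u := - 2 * complex.Re (v * u) - 2 * k * complex.Re (U^* * u).
pose A := 1 + k * normc U ^+ 2.
have HB u : H u <= A + B u.
  rewrite -subr_ge0.
  have -> : A + B u - H u = k * normc (u - U) ^+ 2.
    rewrite /A /B /H; case: (U) => U1 U2; case: (u) => u1 u2.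
    by rewrite !sqr_normcE /=; ring.
  by rewrite mulr_ge0 // sqr_ge0.
have BD u u' : B (u + u') = B u + B u'.
  by rewrite /B !mulrDr !ReD; ring.
have B0 : B 0 = 0 by rewrite /B; case: (v) => ? ?; case: (U) => ? ? /=; ring.
have Bn u n : B (u *+ n) = B u *+ n.
  by elim: n => [|n IH]; rewrite ?mulr0n // !mulrS BD IH.
have Bsum : \sum_(r <- rs) B (z - r)^-1 = B U *+ m.
  by rewrite -(big_morph B BD B0) sumE Bn.
have A0 : 0 <= A by rewrite /A addr_ge0 // mulr_ge0 // sqr_ge0.
have AB : A + B U = H U.
  by rewrite /A /B /H; case: (U) => U1 U2; rewrite !sqr_normcE /=; ring.
have ABr r : r \in rs -> 0 < A + B (z - r)^-1.
  move=> rin; apply: lt_le_trans (HB _).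
  have zr0 : z - r != 0 by rewrite subr_eq0; apply: contraNneq znr => ->.
  rewrite HE ?invr_neq0 // invrK opprB addrCA subrr addr0.
  rewrite mulr_gt0 ?exprn_gt0 ?normc_gt0 ?invr_neq0 // subr_gt0.
  by rewrite ltr_sqr ?nnegrE ?normc_ge0 // rsn.
have U0 : U != 0 by rewrite invr_neq0.
case: rs {prs pzE dzE} srs rsn znr sumE Bsum ABr => [|r rs] /= srs rsn znr sumE Bsum ABr.
  move/eqP: sumE; rewrite big_nil eq_sym -mulr_natr mulf_eq0 (negPf U0) /=.
  by rewrite pnatr_eq0 -leqn0 leqNgt m0.
have : 0 < \sum_(r' <- r :: rs) (A + B (z - r')^-1).
  rewrite big_cons ltr_wpDr //; last by apply: ABr; rewrite mem_head.
  rewrite big_seq sumr_ge0 // => r' rin; apply/ltW/ABr.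
  by rewrite inE rin orbT.
rewrite big_split /= Bsum big_const_seq count_predT iter_addr_0 => lt0.
(* Roots missing from the degree bound [m] count as roots at infinity, where the tangent takes the
   value [A >= 0]. *)
have : 0 < H U *+ m.
  rewrite -AB mulrnDl; apply: lt_le_trans lt0 _.
  by rewrite lerD2r ler_wpMn2l.
by rewrite pmulrn_lgt0 // ltNge HU.
Qed.
End Complex.

(** * Polar forms and the Grace-Walsh-Szego theorem *)

Section Coincidence.
Variable R : rcfType.
Implicit Types (z w u t s : R[i]) (zs ws : seq R[i]) (A : nat -> R[i]).

(* [polar A ws] is the value at [ws] of the symmetric multiaffine polynomial
   [\sum_k A k * e_k], whose diagonal restriction is [diagp (size ws) A]. *)
Fixpoint polar A ws : R[i] :=
  if ws is w :: ws' then polar (fun k => A k + w * A k.+1) ws' else A 0%N.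

Definition diagp (m : nat) A : {poly R[i]} :=
  \poly_(k < m.+1) (A k *+ 'C(m, k)).

(** On the diagonal, fixing one argument of the symmetric form at [w] amounts to taking the polar
    derivative with respect to [w], which is the expression treated by [laguerre]. *)
Lemma diagp_step m A w :
  (diagp m (fun k => A k + w * A k.+1)) *+ m.+1 =
  diagp m.+1 A *+ m.+1 - ('X - w%:P) * (diagp m.+1 A)^`().
Proof.
apply/polyP => k.
rewrite mulrBl coefB coefMn coefB coefMn coefXM coefCM !coef_deriv !coef_poly.
pose N (j : nat) : R[i] := j%:R.
have MN (x : R[i]) j : x *+ j = x * N j by rewrite /N mulr_natr.
have NM i j : N (i * j)%N = N i * N j by rewrite /N natrM.
have ND i j : N (i + j)%N = N i + N j by rewrite /N natrD.
have e1 : N m.+1 * N 'C(m, k) = N k.+1 * N 'C(m.+1, k.+1).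
  by rewrite -!NM mul_bin_diag.
have e2 : (k <= m.+1)%N ->
  N m.+1 * N 'C(m.+1, k) = N m.+1 * N 'C(m, k) + N k * N 'C(m.+1, k).
  move=> km; rewrite -!NM -ND; congr N.
  have /= -> := mul_bin_down m.+1 k.
  by rewrite -mulnDl subnK.
have N0 : N 0%N = 0 by [].
have N1 : N 1%N = 1 by [].
clearbody N; rewrite !ltnS !MN.
case: (leqP k m) => km.
  rewrite (leqW km).
  have -> : (if k == 0%N then 0 else
      (if (k.-1 <= m)%N then A k.-1.+1 * N 'C(m.+1, k.-1.+1) else 0) * N k.-1.+1)
      = A k * (N k * N 'C(m.+1, k)).
    case: k km {e1 e2} => [|k] km; first by rewrite N0 mul0r mulr0.
    by rewrite /= (ltnW km); ring.
  have := e2 (leqW km) => e2'.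
  transitivity (A k * (N m.+1 * N 'C(m, k)) + w * A k.+1 * (N m.+1 * N 'C(m, k))).
    by ring.
  have -> : N m.+1 * N 'C(m, k) = N m.+1 * N 'C(m.+1, k) - N k * N 'C(m.+1, k).
    by rewrite e2'; ring.
  have -> : w * A k.+1 * (N m.+1 * N 'C(m.+1, k) - N k * N 'C(m.+1, k))
      = w * A k.+1 * (N k.+1 * N 'C(m.+1, k.+1)).
    by rewrite -e1 e2'; ring.
  by ring.
rewrite mul0r.
case: (eqVneq k m.+1) => [->|kn].
  by rewrite leqnn /= leqnn; ring.
have -> : (k <= m.+1)%N = false by lia.
case: k km kn {e1 e2} => [//|k] /= km kn.
have -> : (k <= m)%N = false by lia.
by ring.
Qed.

Lemma size_diagp m A : (size (diagp m A) <= m.+1)%N.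
Proof. exact: size_poly. Qed.

(** The arguments are fixed one at a time: by [laguerre], each new diagonal polynomial still has no
    zero in the disk, until only the constant [A 0] is left. *)
Theorem grace_walsh_szego m A ws z0 (q : R) :
  size ws = m -> 0 <= q -> (forall w, w \in ws -> normc (w - z0) <= q) ->
  (forall t, normc (t - z0) <= q -> (diagp m A).[t] != 0) ->
  polar A ws != 0.
Proof.
move=> sw q0; elim: ws m A sw => [|w ws IH] m A /= sw wq dn0.
  have := dn0 z0; rewrite subrr normc0 => /(_ q0).
  by rewrite -sw /diagp poly_def big_ord1 bin0 mulr1n expr0 hornerZ hornerC mulr1.
case: m sw dn0 => // m [sw] dn0.
apply: (IH m) => // [w' w'in|t tq]; first by apply: wq; rewrite inE w'in orbT.
have := laguerre (size_diagp m.+1 A) isT q0 dn0 tq (wq w (mem_head _ _)).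
have := congr1 (fun p : {poly R[i]} => p.[t]) (diagp_step m A w).
rewrite hornerD hornerN hornerM !hornerE !hornerMn => <-.
by apply: contraNneq => ->; rewrite mul0rn.
Qed.

Lemma eq_polar A A' ws : A =1 A' -> polar A ws = polar A' ws.
Proof.
elim: ws A A' => [|w ws IH] A A' e /=; first exact: e.
by apply: IH => k; rewrite !e.
Qed.

Lemma polar_sub_const A ws l :
  polar (fun k => A k - (if k == 0%N then l else 0)) ws = polar A ws - l.
Proof.
elim: ws A => [|w ws IH] A //=.
rewrite -IH; apply: eq_polar => k /=; rewrite subr0; ring.
Qed.

(** The coincidence theorem in contrapositive form, by a shift of the constant coefficient: a value
    of the polar form on the disk is also a value of the diagonal there. *)
Corollary coincidence m A ws z0 (q : R) l :
  size ws = m -> 0 <= q -> (forall w, w \in ws -> normc (w - z0) <= q) ->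
  (forall t, normc (t - z0) <= q -> (diagp m A).[t] != l) ->
  polar A ws != l.
Proof.
move=> sw q0 wq dl; rewrite -subr_eq0 -polar_sub_const.
apply: (grace_walsh_szego sw q0 wq) => t tq.
suff -> : diagp m (fun k => A k - (if k == 0%N then l else 0)) = diagp m A - l%:P.
  by rewrite hornerD hornerN hornerC subr_eq0 dl.
apply/polyP => k; rewrite coefB coefC !coef_poly.
case: k => [|k] /=; first by rewrite bin0 !mulr1n.
by rewrite !subr0.
Qed.

Lemma size_prod_lin ws :
  (size (\prod_(w <- ws) (1 + w%:P * 'X))%R <= (size ws).+1)%N.
Proof.
elim: ws => [|w ws IH]; first by rewrite big_nil size_poly1.
rewrite big_cons (leq_trans (size_polyMleq _ _)) //=.
have : (size (1 + w%:P * 'X : {poly R[i]})%R <= 2)%N.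
  rewrite (leq_trans (size_polyD _ _)) // geq_max size_poly1 mul_polyC.
  by rewrite (leq_trans (size_scale_leq _ _)) // size_polyX.
by move=> h; rewrite -subn1 leq_subLR (leq_trans (leq_add h IH)).
Qed.

(** The coefficients of the product are the elementary symmetric functions of [ws], so [polar] is
    the linear functional [X^k -> A k] applied to this product. *)
Lemma polarE A ws : polar A ws =
  \sum_(k < (size ws).+1) (\prod_(w <- ws) (1 + w%:P * 'X))`_k * A k.
Proof.
elim: ws A => [|w ws IH] A.
  by rewrite big_ord1 big_nil coefC eqxx mul1r.
rewrite /= IH big_cons.
set g := \prod_(w <- ws) _; set m := size ws in IH *.
have gm : g`_m.+1 = 0 by rewrite nth_default // size_prod_lin.
have -> : \sum_(k < m.+2) ((1 + w%:P * 'X) * g)`_k * A k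
  = \sum_(k < m.+2) g`_k * A k + \sum_(k < m.+2) (w * ('X * g)`_k) * A k.
  by rewrite -big_split; apply: eq_bigr => k _ /=; rewrite mulrDl mul1r coefD -mulrA coefCM mulrDl.
rewrite [X in _ = X + _]big_ord_recr /= gm mul0r addr0.
rewrite [X in _ + X]big_ord_recl /= coefXM eqxx mulr0 mul0r add0r -big_split.
apply: eq_bigr => k _ /=.
by rewrite /bump /= coefXM /= mulrDr; congr (_ + _); ring.
Qed.

(** For [A k = s^(k+1) / (k+1)] that functional is integration from 0 to [s], here of [(1 + t u)^m].
    The factor [t] stays on the left since it may vanish. *)
Lemma diagp_pow s m t :
  (diagp m (fun k => s ^+ k.+1 / k.+1%:R)).[t] * (t * m.+1%:R) = (1 + t * s) ^+ m.+1 - 1.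
Proof.
rewrite exprDn big_ord_recl /= subn0 expr1n expr0 mul1r bin0 mulr1n addrAC subrr add0r.
rewrite horner_poly mulr_suml; apply: eq_bigr => k _ /=.
rewrite expr1n mul1r /bump leq0n add1n -[_ *+ 'C(m, k)]mulr_natr -[_ *+ 'C(m.+1, _)]mulr_natr.
have e : m.+1%:R * 'C(m, k)%:R = k.+1%:R * 'C(m.+1, k.+1)%:R :> R[i].
  by rewrite -!natrM mul_bin_diag.
have k0 : k.+1%:R != 0 :> R[i] by rewrite pnatr_eq0.
rewrite exprMn.
transitivity (t ^+ k.+1 * s ^+ k.+1 * (m.+1%:R * 'C(m, k)%:R) / k.+1%:R).
  by rewrite !exprS; ring.
by rewrite e; field; rewrite addrC natr1.
Qed.
End Coincidence.

(** * Values of a polynomial in terms of its critical points *)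

Section CriticalPoints.
Variable R : rcfType.
Implicit Types (z w u t s a : R[i]) (zs ws zts : seq R[i]) (P G : {poly R[i]}).

Lemma horner_antideriv G (d : R[i]) ws s :
  G.[0] = 0 -> G^`() = d *: \prod_(w <- ws) (1 + w%:P * 'X) ->
  G.[s] = d * polar (fun k => s ^+ k.+1 / k.+1%:R) ws.
Proof.
set g := \prod_(w <- ws) _ => G0 dG.
have cG k : G`_k.+1 = d * g`_k / k.+1%:R.
  have k0 : k.+1%:R != 0 :> R[i] by rewrite pnatr_eq0.
  by apply: (mulIf k0); rewrite mulfVK // mulr_natr -coef_deriv dG coefZ.
have sG : (size G <= (size ws).+2)%N.
  apply/leq_sizeP => -[|k] // hk; rewrite cG nth_default ?mulr0 ?mul0r //.
  exact: leq_trans (size_prod_lin ws) _.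
rewrite (horner_coef_wide _ sG) big_ord_recl /= -horner_coef0 G0 mul0r add0r.
rewrite polarE mulr_sumr; apply: eq_bigr => k _ /=.
by rewrite /bump add1n cG -/g; ring.
Qed.

Lemma horner_polar P a z zts (m : nat) :
  size zts = m -> P^`() = m.+1%:R *: \prod_(w <- zts) ('X - w%:P) ->
  P.[a] = 0 -> (forall w, w \in zts -> w != a) ->
  P.[z] = - P^`().[a] *
    polar (fun k => (a - z) ^+ k.+1 / k.+1%:R) [seq (w - a)^-1 | w <- zts].
Proof.
move=> sz dP Pa zta.
(* [G] vanishes at 0, and pulling [a - w] out of each factor of its derivative leaves
   [1 + u / (w - a)], with [- P'(a)] in front. *)
pose G := P \Po (a%:P - 'X).
have Gz u : G.[u] = P.[a - u] by rewrite horner_comp !hornerE.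
rewrite -[in LHS](subKr a z) -Gz; apply: horner_antideriv; first by rewrite Gz subr0.
rewrite deriv_comp derivB derivC derivX sub0r mulrN1 dP.
rewrite hornerZ comp_polyZ big_map scaleNr -scalerA; congr (- (_ *: _)).
elim: zts zta {sz dP} => [|w zts IH] zta.
  by rewrite !big_nil comp_polyC hornerC scale1r.
rewrite !big_cons comp_polyM IH; last by move=> u uin; apply: zta; rewrite inE uin orbT.
rewrite comp_polyB comp_polyX comp_polyC hornerM !hornerE.
have wa : w - a != 0 by rewrite subr_eq0 zta ?mem_head.
have -> : a%:P - 'X - w%:P = (a - w) *: (1 + (w - a)^-1%:P * 'X).
  rewrite scalerDr -mul_polyC mulr1 mul_polyC scalerA.
  rewrite -[a - w]opprB mulNr divff // scaleN1r !polyCN polyCB; ring.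
by rewrite -scalerAl -scalerAr scalerA.
Qed.

Section Bounds.
Variables (P : {poly R[i]}) (a z : R[i]) (zts : seq R[i]) (m : nat) (q : R).
Hypothesis sz : size zts = m.
Hypothesis dP : P^`() = m.+1%:R *: \prod_(w <- zts) ('X - w%:P).
Hypothesis Pa : P.[a] = 0.
Hypothesis zta : forall w, w \in zts -> w != a.
Hypothesis za : z != a.
Hypothesis q01 : 0 <= q < 1.
Hypothesis ztq : forall w, w \in zts -> normc (w - z) <= q * normc (w - a).

Let s := a - z.

Let s0 : s != 0. Proof. by rewrite subr_eq0 eq_sym. Qed.

Let disk_eq t : normc (t + s^-1) * normc s = normc (1 + t * s).
Proof. by rewrite -normcM mulrDl mulVf // addrC. Qed.

(** For [t = 1 / (w - a)] one has [1 + t s = (w - z) / (w - a)]: the hypothesis on [w] becomes a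
    disk of centre [- 1/s], as the coincidence theorem requires. *)
Let ts_in t : t \in [seq (w - a)^-1 | w <- zts] -> normc (t - - s^-1) <= q / normc s.
Proof.
move=> /mapP[w win ->]; rewrite opprK ler_pdivlMr ?normc_gt0 // disk_eq.
have wa : w - a != 0 by rewrite subr_eq0 zta.
have -> : 1 + (w - a)^-1 * s = (w - z) / (w - a) by rewrite /s; field.
by rewrite normcM normcV ler_pdivrMr ?normc_gt0 // ztq.
Qed.

(** By [diagp_pow], [v |t| (m + 1) = |(1 + t s)^(m+1) - 1|], while [|t| |s|] lies between [1 - x]
    and [1 + x]. *)
Let val t : normc (t - - s^-1) <= q / normc s ->
  let x := normc (1 + t * s) in let v := normc (diagp m (fun k => s ^+ k.+1 / k.+1%:R)).[t] in
  [/\ 0 <= x <= q, 1 - x ^+ m.+1 <= v * ((1 + x) / normc s * m.+1%:R)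
    & v * ((1 - x) / normc s * m.+1%:R) <= 1 + x ^+ m.+1].
Proof.
rewrite opprK ler_pdivlMr ?normc_gt0 // disk_eq => xq x v.
have x0 : 0 <= x := normc_ge0 _.
have x1 : x < 1 by case/andP: q01 => _; apply: le_lt_trans.
have ns : 0 < normc s by rewrite normc_gt0.
have e : v * (normc t * m.+1%:R) = normc ((1 + t * s) ^+ m.+1 - 1).
  by rewrite -diagp_pow !normcM normc_nat.
have v0 : 0 <= v := normc_ge0 _.
have m0 : 0 <= m.+1%:R :> R by rewrite ler0n.
have t1 : normc t * normc s <= 1 + x.
  rewrite -normcM (_ : t * s = (1 + t * s) + - 1); last by ring.
  by apply: le_trans (le_normcD _ _) _; rewrite normcN normc1 addrC.
have t2 : 1 - x <= normc t * normc s.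
  rewrite -normcM lerBlDr.
  have := le_normcD (1 + t * s) (- (t * s)).
  by rewrite addrK normc1 normcN [_ + x]addrC.
have u1 : 1 - x ^+ m.+1 <= normc ((1 + t * s) ^+ m.+1 - 1).
  rewrite lerBlDr -[1 in X in X <= _]normc1 -normcX.
  have := le_normcD (1 - (1 + t * s) ^+ m.+1) ((1 + t * s) ^+ m.+1).
  by rewrite subrK (normc_sub 1).
have u2 : normc ((1 + t * s) ^+ m.+1 - 1) <= 1 + x ^+ m.+1.
  by apply: le_trans (le_normcD _ _) _; rewrite normcN normc1 normcX addrC.
split; first by rewrite x0.
  apply: le_trans u1 _; rewrite -e; apply: ler_wpM2l => //; apply: ler_wpM2r => //.
  by rewrite ler_pdivlMr.
apply: le_trans u2; rewrite -e; apply: ler_wpM2l => //; apply: ler_wpM2r => //.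
by rewrite ler_pdivrMr.
Qed.

Let q0 : 0 <= q / normc s.
Proof. by case/andP: q01 => ? _; rewrite divr_ge0 ?normc_ge0. Qed.

Let sts : size [seq (w - a)^-1 | w <- zts] = m.
Proof. by rewrite size_map. Qed.

(** The lower bound of [val] for the diagonal is weakest at [x = q]; a polar value [l] below it
    would be omitted by the diagonal on the disk, and the coincidence theorem would give
    [l != l]. *)
Lemma normc_horner_ge :
  normc P^`().[a] * (normc (a - z) * (1 - q ^+ m.+1)) <= normc P.[z] * (m.+1%:R * (1 + q)).
Proof.
rewrite (horner_polar z sz dP Pa zta) normcM normcN -mulrA.
apply: ler_wpM2l; first exact: normc_ge0.
rewrite -/s leNgt; apply/negP => lt.
set l := polar _ _ in lt.
have /negP : l != l; last by apply.
apply: (coincidence sts q0 ts_in) => t tin.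
apply/eqP => el; have [/andP[x0 xq] h _] := val tin; move: h; rewrite el.
set x := normc _ in x0 xq *.
have ns : 0 < normc s by rewrite normc_gt0.
apply/negP; rewrite -ltNge -(ltr_pM2l ns).
rewrite (_ : _ * (normc l * _) = normc l * (m.+1%:R * (1 + x))); last first.
  by field; rewrite gt_eqF.
have l0 : 0 <= normc l := normc_ge0 _.
apply: (@le_lt_trans _ _ (normc l * (m.+1%:R * (1 + q)))).
  by apply: ler_wpM2l => //; apply: ler_wpM2l; rewrite ?ler0n // lerD2l.
apply: lt_le_trans lt _.
apply: ler_wpM2l; first exact: ltW.
by rewrite lerD2l lerN2; apply: lerXn2r; rewrite // nnegrE ?(le_trans x0).
Qed.

Lemma normc_horner_le :
  normc P.[z] * (m.+1%:R * (1 - q)) <= normc P^`().[a] * (normc (a - z) * 2).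
Proof.
rewrite (horner_polar z sz dP Pa zta) normcM normcN -mulrA.
apply: ler_wpM2l; first exact: normc_ge0.
rewrite -/s leNgt; apply/negP => lt.
set l := polar _ _ in lt.
have /negP : l != l; last by apply.
apply: (coincidence sts q0 ts_in) => t tin.
apply/eqP => el; have [/andP[x0 xq] _ h] := val tin; move: h; rewrite el.
set x := normc _ in x0 xq *.
have ns : 0 < normc s by rewrite normc_gt0.
have x1 : x <= 1 by case/andP: q01 => _ /ltW; apply: le_trans.
apply/negP; rewrite -ltNge -(ltr_pM2l ns).
rewrite (_ : _ * (normc l * _) = normc l * (m.+1%:R * (1 - x))); last first.
  by field; rewrite gt_eqF.
have l0 : 0 <= normc l := normc_ge0 _.
apply: (@lt_le_trans _ _ (normc l * (m.+1%:R * (1 - q)))); last first.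
  by apply: ler_wpM2l => //; apply: ler_wpM2l; rewrite ?ler0n // lerD2l lerN2.
apply: le_lt_trans lt; apply: ler_wpM2l; first exact: ltW.
have : x ^+ m.+1 <= 1 by apply: exprn_ile1.
by lra.
Qed.
End Bounds.
End CriticalPoints.

(** * Geometry of the zeros, of the lens and of pseudo-hyperbolic disks *)

Section Geometry.
Variable R : rcfType.
Implicit Types (z w u : R[i]) (zs zts : seq R[i]) (P : {poly R[i]}) (a b c r x y M : R).

Lemma normc_le z a : 0 <= a -> (normc z <= a) = (normc z ^+ 2 <= a ^+ 2).
Proof. by move=> a0; rewrite ler_sqr ?nnegrE ?normc_ge0. Qed.

Lemma Re_le_normc z : complex.Re z <= normc z.
Proof.
apply: le_trans (ler_norm _) _; rewrite -ler_sqr ?nnegrE ?normc_ge0 //.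
by rewrite real_normK ?num_real // sqr_normcE lerDl sqr_ge0.
Qed.

(** If [|w| > 1 >= |z|], then [u = w / (w - z)] satisfies [|u - 1| < |u|], so its real part is
    positive and the logarithmic derivative cannot vanish at [w]. *)
Lemma gauss_lucas_unit_disk zs w : (0 < size zs)%N ->
  (forall z, z \in zs -> normc z <= 1) ->
  root (\prod_(z <- zs) ('X - z%:P))^`() w -> normc w <= 1.
Proof.
move=> s0 zs1 /rootP dw; rewrite leNgt; apply/negP => w1.
have wz : w \notin zs by apply/negP => /zs1; rewrite leNgt w1.
have w0 : w != 0 by rewrite -normc_gt0 (lt_trans ltr01).
move: dw; rewrite deriv_prod_XsubC_horner // => /eqP; rewrite mulf_eq0 => /orP[].
  rewrite prodf_seq_eq0 => /hasP[z zin /=]; rewrite subr_eq0 => /eqP e.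
  by rewrite e zin in wz.
move=> /eqP sum0.
have pos z : z \in zs -> 0 < complex.Re (w * (w - z)^-1).
  move=> zin; have wz0 : w - z != 0 by rewrite subr_eq0; apply: contraNneq wz => ->.
  set u := w * _.
  have : normc (u - 1) ^+ 2 < normc u ^+ 2.
    rewrite ltr_sqr ?nnegrE ?normc_ge0 //.
    have -> : u - 1 = z / (w - z) by rewrite /u; field.
    rewrite /u !normcM ltr_pM2r ?normcV ?invr_gt0 ?normc_gt0 //.
    exact: le_lt_trans (zs1 _ zin) w1.
  rewrite !sqr_normcE; case: (u) => u1 u2 /=; rewrite subr0 => ?; nra.
have : complex.Re (w * \sum_(z <- zs) (w - z)^-1) = 0 by rewrite sum0 mulr0.
rewrite mulr_sumr Re_sum.
case: zs s0 pos {zs1 wz sum0} => // z zs _ pos /eqP.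
rewrite big_cons gt_eqF // ltr_wpDr ?pos ?mem_head //.
rewrite big_seq sumr_ge0 // => z' zin; apply/ltW/pos; by rewrite inE zin orbT.
Qed.

Lemma sum_critical zs zts (m : nat) : size zs = m.+1 -> size zts = m ->
  (\prod_(z <- zs) ('X - z%:P))^`() = m.+1%:R *: \prod_(w <- zts) ('X - w%:P) ->
  m.+1%:R * \sum_(w <- zts) w = m%:R * \sum_(z <- zs) z.
Proof.
move=> s1 s2 e; case: m s1 s2 e => [|m] s1 s2 e.
  by rewrite (size0nil s2) big_nil mulr0 mul0r.
have := congr1 (fun p : {poly R[i]} => p`_m) e.
rewrite coef_deriv coefZ.
have := @coefPn_prod_XsubC _ zs; rewrite s1 /= => -> //.
have := @coefPn_prod_XsubC _ zts; rewrite s2 /= => -> //.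
by rewrite mulNrn mulrN => /oppr_inj <-; rewrite mulr_natl.
Qed.

(** At [u = 1/c] every zero is at distance at least [(1 - c) / c], so the logarithmic derivative is
    at most [(m + 1) c / (1 - c)] in modulus. *)
Lemma prod_reversed_critical zs zts (m : nat) c : size zs = m.+1 -> size zts = m ->
  (\prod_(z <- zs) ('X - z%:P))^`() = m.+1%:R *: \prod_(w <- zts) ('X - w%:P) ->
  (forall z, z \in zs -> normc z <= 1) -> 0 < c < 1 ->
  (\prod_(w <- zts) normc (1 - c%:C * w)) * (1 - c) <= \prod_(z <- zs) normc (1 - c%:C * z).
Proof.
move=> s1 s2 e zs1 /andP[c0 c1].
pose u : R[i] := (c^-1)%:C.
have cu : c%:C * u = 1 by rewrite /u -rmorphM /= divff ?gt_eqF.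
have cE z : normc (1 - c%:C * z) = c * normc (u - z).
  by rewrite -cu -mulrBr normcM normcR gtr0_norm.
have uz z : z \in zs -> (1 - c) / c <= normc (u - z).
  move=> /zs1 z1; have := le_normcD (u - z) z; rewrite subrK normcR gtr0_norm ?invr_gt0 //.
  have -> : (1 - c) / c = c^-1 - 1 by field; rewrite gt_eqF.
  by move=> h; rewrite lerBlDr (le_trans h) // lerD2l.
have k0 : 0 < (1 - c) / c by rewrite divr_gt0 // subr_gt0.
have unz : u \notin zs.
  by apply/negP => /uz; rewrite subrr normc0 leNgt k0.
have := congr1 (fun p : {poly R[i]} => normc p.[u]) e.
rewrite deriv_prod_XsubC_horner // hornerZ horner_prod !normcM normc_nat !normc_prod.
under [in X in _ = _ * X -> _]eq_bigr do rewrite !hornerE.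
move=> E.
have : normc (\sum_(z <- zs) (u - z)^-1) <= m.+1%:R * (c / (1 - c)).
  have : forall l, {subset l <= zs} ->
     normc (\sum_(z <- l) (u - z)^-1) <= (size l)%:R * (c / (1 - c)).
    elim=> [|z l IH] sl; first by rewrite big_nil normc0 mul0r.
    rewrite big_cons (le_trans (le_normcD _ _)) //= -natr1 mulrDl mul1r addrC lerD ?IH //.
      by move=> t tl; apply: sl; rewrite inE tl orbT.
    rewrite normcV -[c / _]invf_div lef_pV2 ?posrE // ?uz ?sl ?mem_head //.
    by apply: lt_le_trans k0 (uz _ _); rewrite sl ?mem_head.
  by move=> /(_ zs) h; rewrite -s1; apply: h.
set S := normc _ => S1.
have PE l : \prod_(z <- l) normc (1 - c%:C * z) = c ^+ size l * \prod_(z <- l) normc (u - z).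
  elim: l => [|z l IH]; first by rewrite !big_nil mulr1.
  by rewrite !big_cons IH cE exprS; ring.
rewrite !PE s1 s2 exprS.
set A := \prod_(z <- zs) _ in E *; set B := \prod_(w <- zts) _ in E *.
have A0 : 0 <= A by apply: prodr_ge0 => z _; apply: normc_ge0.
have n0 : 0 < m.+1%:R :> R by rewrite ltr0n.
(* There is one more zero than there are critical points; the resulting extra factor [c] is the
   numerator of [c / (1 - c)]. *)
have B1 : B * (1 - c) <= c * A.
  rewrite -(ler_pM2l n0) mulrA -E.
  have c10 : 0 < 1 - c by rewrite subr_gt0.
  rewrite -ler_pdivlMr //; apply: le_trans (ler_wpM2l A0 S1) _.
  by rewrite le_eqVlt; apply/orP; left; apply/eqP; field; rewrite gt_eqF.
have cm : 0 <= c ^+ m by rewrite exprn_ge0 // ltW.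
by rewrite [c * c ^+ m]mulrC -!mulrA; apply: ler_wpM2l.
Qed.

Lemma ReMl w x : complex.Re (w * x%:C) = complex.Re w * x.
Proof. by case: w => w1 w2 /=; rewrite mulr0 subr0. Qed.

(** The real mean value theorem is applied to [Re (w P(x))], where [w] is the conjugate of the
    increment [d]: the increment of this real polynomial is [|d|^2]. *)
Lemma poly_mean_value P b M : 0 < b ->
  (forall x, 0 <= x <= b -> normc P^`().[x%:C] <= M) ->
  normc (P.[b%:C] - P.[0]) <= b * M.
Proof.
move=> b0 PM; set d := P.[_] - _.
have [d0|dn0] := eqVneq d 0.
  rewrite d0 normc0 mulr_ge0 ?(ltW b0) // (le_trans (normc_ge0 _) (PM 0 _)) //.
  by rewrite lexx (ltW b0).
pose w := d^* .
pose Rep (Q : {poly R[i]}) := \poly_(i < size Q) complex.Re (w * Q`_i).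
have RepE Q i : (Rep Q)`_i = complex.Re (w * Q`_i).
  rewrite coef_poly; case: ltnP => // h.
  by rewrite nth_default // mulr0.
have Reph Q x : (Rep Q).[x] = complex.Re (w * Q.[x%:C]).
  rewrite horner_poly horner_coef mulr_sumr.
  elim/big_rec2: _ => //= i y1 y2 _ ->; rewrite ReD; congr (_ + _).
  by rewrite -rmorphXn mulrA ReMl.
have Repd Q : (Rep Q)^`() = Rep Q^`().
  apply/polyP => i; rewrite coef_deriv !RepE coef_deriv.
  by rewrite -[LHS]mulr_natr -[_ *+ i.+1 in RHS]mulr_natr mulrA -(rmorph_nat (real_complex R)) ReMl.
have [x /andP[x0 xb]] := poly_mvt (Rep P) b0.
rewrite Repd !Reph subr0 => e.
have wd : complex.Re (w * P.[b%:C]) - complex.Re (w * P.[0%:C]) = normc d ^+ 2.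
  have -> : complex.Re (w * P.[b%:C]) - complex.Re (w * P.[0%:C]) = complex.Re (w * d).
    by rewrite mulrBr; case: (w * _) => ? ?; case: (w * _) => ? ?.
  by rewrite /w sqr_normcE; case: (d) => d1 d2 /=; ring.
have nw : normc w = normc d by rewrite /w; case: (d) => d1 d2 /=; rewrite sqrrN.
have dp : 0 < normc d by rewrite normc_gt0.
rewrite -(ler_pM2l dp) -expr2 -wd e.
have h : complex.Re (w * P^`().[x%:C]) <= normc d * M.
  apply: le_trans (Re_le_normc _) _; rewrite normcM nw.
  apply: ler_wpM2l; first exact: normc_ge0.
  by apply: PM; rewrite !ltW.
by apply: le_trans (ler_wpM2r (ltW b0) h) _; rewrite -mulrA [M * b]mulrC.
Qed.

(** After multiplication by [a], the difference of the two sides is a nonnegative combination of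
    [1 - |w|^2] and [|w - a|^2 - 1]. *)
Lemma lens_contract w a x : 0 < a -> 0 <= x <= a -> a <= 1 ->
  normc w <= 1 -> 1 <= normc (w - a%:C) ->
  normc (w - x%:C) ^+ 2 <= (1 - x * (a - x)) * normc (w - a%:C) ^+ 2.
Proof.
move=> a0 /andP[x0 xa] a1; rewrite (normc_le _ ler01) expr1n => w1 wa.
have {wa}: 1 <= normc (w - a%:C) ^+ 2 by rewrite exprn_ege1.
move: w1; rewrite !sqr_normcE; case: w => y v /=; rewrite subr0 => w1 wa.
rewrite -(ler_pM2l a0) -subr_ge0.
set N := y ^+ 2 + v ^+ 2 in w1.
set D := (y - a) ^+ 2 + v ^+ 2 in wa *.
have -> : a * ((1 - x * (a - x)) * D) - a * ((y - x) ^+ 2 + v ^+ 2)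
   = (a - x) * ((1 - N) + (D - 1) * (1 - a * x)).
  by rewrite /N /D; ring.
by rewrite mulr_ge0 ?subr_ge0 // addr_ge0 ?subr_ge0 // mulr_ge0 ?subr_ge0 //; nra.
Qed.

Lemma lens_Re w a : 0 < a -> normc w <= 1 -> 1 <= normc (w - a%:C) ->
  complex.Re w <= a / 2.
Proof.
move=> a0; rewrite (normc_le _ ler01) expr1n => w1 wa.
have {wa}: 1 <= normc (w - a%:C) ^+ 2 by rewrite exprn_ege1.
move: w1; rewrite !sqr_normcE; case: w => y v /=; rewrite subr0 => w1 wa.
by rewrite -subr_ge0 -(pmulr_rge0 _ a0); nra.
Qed.

(** The drop [|w - a|^2 - |w - x|^2] equals [(a - x) (a + x - 2 Re w)], nonnegative by [lens_Re],
    and [|w - a|^2 <= 4]. *)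
Lemma lens_decay w a x : 0 < a -> 0 <= x <= a -> a <= 1 ->
  normc w <= 1 -> 1 <= normc (w - a%:C) ->
  normc (x%:C - w) ^+ 2 <=
    normc (a%:C - w) ^+ 2 * (1 - (a - x) * (a + x - 2 * complex.Re w) / 4).
Proof.
move=> a0 /andP[x0 xa] a1 w1 wa; have ya := lens_Re a0 w1 wa.
rewrite (normc_le _ ler01) expr1n in w1.
have {wa}: 1 <= normc (w - a%:C) ^+ 2 by rewrite exprn_ege1.
rewrite (normc_sub x%:C) (normc_sub a%:C).
move: ya w1; rewrite !sqr_normcE; case: w => y v /=; rewrite !subr0 => ya w1 wa.
set N := y ^+ 2 + v ^+ 2 in w1.
have k0 : 0 <= (a - x) * (a + x - 2 * y) by rewrite mulr_ge0 ?subr_ge0 //; lra.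
have y1 : -1 <= y by rewrite /N in w1; nra.
have D4 : 0 <= 4 - ((y - a) ^+ 2 + v ^+ 2).
  have h1 : 0 <= a * (y + 1) by rewrite mulr_ge0 ?(ltW a0) //; lra.
  have h2 : 0 <= a * (1 - a) by rewrite mulr_ge0 ?(ltW a0) //; lra.
  have -> : 4 - ((y - a) ^+ 2 + v ^+ 2) =
    (1 - N) + 2 * (a * (y + 1)) + a * (1 - a) + 3 * (1 - a) by rewrite /N; ring.
  by lra.
rewrite -subr_ge0; have := divr_ge0 (mulr_ge0 k0 D4) (ler0n R 4).
by congr (_ <= _); field.
Qed.

Lemma pick_triangle c s z w : 0 < c < 1 -> 0 <= s <= 1 -> normc w = s ->
  z * (1 - c%:C * w) = c%:C - w -> normc z * (1 + c * s) <= c + s.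
Proof.
move=> /andP[c0 c1] /andP[s0 s1] ws e.
have cs0 : 0 <= c + s by rewrite addr_ge0 // ltW.
have h : normc (c%:C - w) ^+ 2 * (1 + c * s) ^+ 2 <= (c + s) ^+ 2 * normc (1 - c%:C * w) ^+ 2.
  have ws2 : normc w ^+ 2 = s ^+ 2 by rewrite ws.
  have us : - s <= complex.Re w.
    by have := Re_le_normc (- w); rewrite normcN ws; case: (w) => ? ? /=; lra.
  move: ws2 us; rewrite !sqr_normcE; case: (w) => u v /= ws2 us.
  rewrite -subr_ge0 !sub0r !mul0r !subr0 addr0 !sqrrN.
  (* The extremal point is [w = - s], where the difference vanishes. *)
  have -> : (c + s) ^+ 2 * ((1 - c * u) ^+ 2 + (c * v) ^+ 2)
     - ((c - u) ^+ 2 + v ^+ 2) * (1 + c * s) ^+ 2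
     = (2 * c * (1 - c ^+ 2) * (1 - s ^+ 2)) * (u + s).
    rewrite exprMn (_ : v ^+ 2 = s ^+ 2 - u ^+ 2); last by rewrite -ws2; ring.
    by ring.
  rewrite mulr_ge0 //; last by lra.
  rewrite mulr_ge0 //; last by nra.
  by rewrite mulr_ge0 //; nra.
have k0 : 0 < normc (1 - c%:C * w).
  rewrite normc_gt0; apply/eqP => k0.
  have : normc (c%:C * w) = 1 by rewrite (_ : c%:C * w = 1) ?normc1 //; apply/eqP; rewrite eq_sym -subr_eq0 k0.
  by rewrite normcM normcR gtr0_norm // ws; nra.
rewrite -ler_sqr ?nnegrE //; last by rewrite mulr_ge0 ?normc_ge0 // addr_ge0 // mulr_ge0 // ltW.
have k2 : 0 < normc (1 - c%:C * w) ^+ 2 by rewrite exprn_gt0.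
by rewrite -(ler_pM2r k2) exprMn mulrAC -[_ * normc (1 - _) ^+ 2]exprMn -normcM e.
Qed.

(** The map [w -> (c - w) / (1 - c w)] is an involution, so [z] is the image of a point of modulus
    [s]. *)
Lemma normc_le_pseudo c s z : 0 < c < 1 -> 0 <= s <= 1 -> 1 - c%:C * z != 0 ->
  normc (c%:C - z) = s * normc (1 - c%:C * z) -> normc z * (1 + c * s) <= c + s.
Proof.
move=> c01 s01 d0 e; apply: (@pick_triangle _ _ _ ((c%:C - z) / (1 - c%:C * z))) => //.
  by rewrite normcM normcV e mulfK // normc_eq0.
by field.
Qed.

(** The pseudo-hyperbolic disk is the Euclidean disk of centre [x0 = c (1 - r^2) / k] and radius
    [r (1 - c^2) / k], where [k = 1 - c^2 r^2]. By the choice of [r] this radius is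
    [c (a - c) / (2 k)], at most [x0 (a - x0) / 2]. *)
Lemma pseudo_disk_subset a c r z : 0 < a < 1 -> 9 / 10 * a <= c -> c < a ->
  a - c <= a * (1 - a) / 10 -> 0 < r <= 1 / 2 -> 2 * r * (1 - c ^+ 2) = c * (a - c) ->
  normc (c%:C - z) < r * normc (1 - c%:C * z) ->
  exists2 x, 0 < x < a & normc (z - x%:C) < x * (a - x) / 2.
Proof.
move=> /andP[a0 a1] c9 ca ac /andP[r0 r1] rE.
have c0 : 0 < c by lra.
have k0 : 0 < 1 - c ^+ 2 * r ^+ 2.
  have cr0 : 0 <= c * r by rewrite mulr_ge0 // ltW.
  have cr : c * r <= 1 * (1 / 2) by apply: ler_pM; lra.
  by rewrite -exprMn; nra.
set k := 1 - _ in k0.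
pose x0 := c * (1 - r ^+ 2) / k.
have xk : x0 * k = c * (1 - r ^+ 2) by rewrite /x0 mulfVK // gt_eqF.
rewrite -ltr_sqr ?nnegrE ?normc_ge0 ?mulr_ge0 ?normc_ge0 1?ltW // exprMn !sqr_normcE => h.
have r21 : 0 < 1 - r ^+ 2 by nra.
have x00 : 0 < x0 by rewrite divr_gt0 // mulr_gt0.
(* The first term is at least [3/4 * 9/10 a (1 - a)], the second at most [a (1 - a) / 10]. Up to the
   factor [k], the margin in [xa] is [c r^2] times this difference. *)
have key : 0 <= (1 - r ^+ 2) * c * (1 - a * c) - (a - c) * (1 - c ^+ 2).
  have : (1 - r ^+ 2) * c * (1 - a * c) >= 3 / 4 * (9 / 10 * a) * (1 - a).
    apply: ler_pM; [nra|nra| |nra]; apply: ler_pM; nra.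
  have : (a - c) * (1 - c ^+ 2) <= a * (1 - a) / 10 by nra.
  nra.
have xa : c * (a - c) <= x0 * (a - x0) * k.
  rewrite mulrAC xk -(ler_pM2r k0) -[c * (1 - _) * _ * k]mulrA [(a - x0) * k]mulrBl xk.
  rewrite -subr_ge0.
  have -> : c * (1 - r ^+ 2) * (a * k - c * (1 - r ^+ 2)) - c * (a - c) * k
    = c * r ^+ 2 * ((1 - r ^+ 2) * c * (1 - a * c) - (a - c) * (1 - c ^+ 2)).
    by rewrite /k; ring.
  by rewrite mulr_ge0 // mulr_ge0 ?(ltW c0) // sqr_ge0.
have ac0 : 0 < c * (a - c) by rewrite mulr_gt0 // subr_gt0.
have X0 : 0 < x0 * (a - x0) by rewrite -(pmulr_lgt0 _ k0); apply: lt_le_trans xa.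
exists x0; first by rewrite x00 /= -subr_gt0 -(pmulr_rgt0 _ x00).
rewrite -ltr_sqr ?nnegrE ?normc_ge0 ?divr_ge0 ?(ltW X0) //.
apply: (@lt_le_trans _ _ ((c * (a - c) / 2 / k) ^+ 2)); last first.
  rewrite ler_sqr ?nnegrE ?divr_ge0 ?(ltW k0) ?(ltW ac0) ?(ltW X0) //.
  by rewrite ler_pdivrMr //; lra.
rewrite expr_div_n ltr_pdivlMr ?exprn_gt0 // sqr_normcE.
have -> : c * (a - c) / 2 = r * (1 - c ^+ 2) by rewrite -rE; field.
move: h; case: z => x y /=; rewrite !subr0 !mul0r !sub0r subr0 addr0 => h.
rewrite -(ltr_pM2l k0) -subr_gt0 in h.
rewrite -subr_gt0; apply: lt_le_trans h _; rewrite le_eqVlt; apply/orP; left; apply/eqP.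
have -> : ((x - x0) ^+ 2 + y ^+ 2) * k ^+ 2
   = k ^+ 2 * (x ^+ 2 + y ^+ 2) - 2 * x * k * (x0 * k) + (x0 * k) ^+ 2 by ring.
by rewrite xk /k; ring.
Qed.
End Geometry.

(** * Consequences of the absence of critical points from the disk *)

Section NoCriticalPoint.
Variable R : rcfType.
Variables (a : R) (zs zts : seq R[i]) (m : nat).
Hypothesis a01 : 0 < a < 1.
Hypothesis szs : size zs = m.
Hypothesis szts : size zts = m.
Hypothesis zs1 : forall z, z \in zs -> normc z <= 1.
Let P : {poly R[i]} := \prod_(z <- a%:C :: zs) ('X - z%:P).
Hypothesis dP : P^`() = m.+1%:R *: \prod_(w <- zts) ('X - w%:P).
Hypothesis zts_far : forall w, w \in zts -> 1 < normc (w - a%:C).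

Let a0 : 0 < a. Proof. by case/andP: a01. Qed.
Let a1 : a <= 1. Proof. by case/andP: a01 => _ /ltW. Qed.

Let all_zs1 z : z \in a%:C :: zs -> normc z <= 1.
Proof. by rewrite inE => /predU1P[->|/zs1 //]; rewrite normcR gtr0_norm. Qed.

Lemma critical_le1 w : w \in zts -> normc w <= 1.
Proof.
move=> win; apply: (@gauss_lucas_unit_disk _ (a%:C :: zs)) => //.
by rewrite -/P dP rootE hornerZ mulf_eq0 -rootE root_prod_XsubC win orbT.
Qed.

Let far w : w \in zts -> 1 <= normc (w - a%:C).
Proof. by move/zts_far/ltW. Qed.

Let zta w : w \in zts -> w != a%:C.
Proof.
by move/far; apply: contraTneq => ->; rewrite subrr normc0 -ltNge ltr01.
Qed.

Let Pa : P.[a%:C] = 0.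
Proof. by apply/rootP; rewrite root_prod_XsubC mem_head. Qed.

Lemma normc_P u : normc P.[u] = normc (u - a%:C) * \prod_(z <- zs) normc (u - z).
Proof.
rewrite /P big_cons hornerM normcM horner_prod normc_prod !hornerE.
by congr (_ * _); apply: eq_bigr => z _; rewrite !hornerE.
Qed.

Lemma normc_dP u : normc P^`().[u] = m.+1%:R * \prod_(w <- zts) normc (u - w).
Proof.
rewrite dP hornerZ normcM normc_nat horner_prod normc_prod.
by congr (_ * _); apply: eq_bigr => w _; rewrite !hornerE.
Qed.

Lemma normc_dP_a_ge : m.+1%:R <= normc P^`().[a%:C].
Proof.
rewrite normc_dP ler_peMr ?ler0n //.
rewrite big_seq; elim/big_rec: _ => // w x win x1.
by rewrite normc_sub mulr_ege1 // far.
Qed.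

Let contract_factor x : 0 < x < a ->
  [/\ 0 <= Num.sqrt (1 - x * (a - x)), Num.sqrt (1 - x * (a - x)) < 1
    & x * (a - x) / 2 <= 1 - Num.sqrt (1 - x * (a - x))].
Proof.
move=> /andP[x0 xa]; have a1' := a1.
have X0 : 0 < x * (a - x) by rewrite mulr_gt0 // subr_gt0.
have X1 : x * (a - x) <= 1 * 1 by apply: ler_pM; lra.
have q0 := sqrtr_ge0 (1 - x * (a - x)).
have := @sqr_sqrtr R (1 - x * (a - x)); set q := Num.sqrt _ in q0 *.
set X := x * (a - x) in X0 X1 *; move=> h.
have {}h : q ^+ 2 = 1 - X by apply: h; lra.
have q1 : q < 1 by nra.
have := sqr_ge0 (1 - q) => h'; split => //; nra.
Qed.

Let contract w x : w \in zts -> 0 < x < a ->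
  normc (w - x%:C) <= Num.sqrt (1 - x * (a - x)) * normc (w - a%:C).
Proof.
move=> win xa; have [q0 q1 _] := contract_factor xa; case/andP: xa => x0 xa; have a1' := a1.
have X1 : x * (a - x) <= 1 * 1 by apply: ler_pM; lra.
rewrite -ler_sqr ?nnegrE ?normc_ge0 ?mulr_ge0 ?normc_ge0 // exprMn sqr_sqrtr; last by lra.
by apply: lens_contract => //; rewrite ?(ltW x0) ?(ltW xa) // ?critical_le1 // far.
Qed.

Let normc_aB x : x < a -> normc (a%:C - x%:C) = a - x.
Proof. by move=> xa; rewrite -rmorphB normcR gtr0_norm // subr_gt0. Qed.

Let xna (x : R) : x < a -> x%:C != a%:C.
Proof. by move=> xa; apply: contraTneq xa => /complexI ->; rewrite ltxx. Qed.

Lemma normc_P_ge x q : 0 < x < a -> q = Num.sqrt (1 - x * (a - x)) ->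
  normc P^`().[a%:C] * ((a - x) * (1 - q ^+ m.+1)) <= normc P.[x%:C] * (m.+1%:R * (1 + q)).
Proof.
move=> xa ->; have [q0 q1 _] := contract_factor xa; have xa' := andP xa.
have q01 : 0 <= Num.sqrt (1 - x * (a - x)) < 1 by rewrite q0.
have := normc_horner_ge szts dP Pa zta (xna (proj2 xa')) q01 (fun w win => contract win xa).
by rewrite (normc_aB (proj2 xa')).
Qed.

(** In [normc_horner_le] the factor [1 - q] is at least [x (a - x) / 2], and [a - x] cancels. *)
Lemma normc_P_le x : 0 < x < a ->
  normc P.[x%:C] * (m.+1%:R * x) <= normc P^`().[a%:C] * 4.
Proof.
move=> xa; have [q0 q1 qX] := contract_factor xa; have [x0 xa'] := andP xa.
have q01 : 0 <= Num.sqrt (1 - x * (a - x)) < 1 by rewrite q0.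
have := normc_horner_le szts dP Pa zta (xna xa') q01 (fun w win => contract win xa).
rewrite normc_aB // => h.
have ax0 : 0 < a - x by rewrite subr_gt0.
rewrite -(ler_pM2r ax0) -[X in _ <= X]mulrA [4 * _]mulrC.
have : normc P.[x%:C] * (m.+1%:R * (x * (a - x) / 2)) <= normc P^`().[a%:C] * ((a - x) * 2).
  apply: le_trans h; apply: ler_wpM2l; first exact: normc_ge0.
  by apply: ler_wpM2l => //; rewrite ler0n.
set A := normc _; set B := normc _; set n := _%:R => h'.
have -> : A * (n * x) * (a - x) = 2 * (A * (n * (x * (a - x) / 2))) by field.
have -> : B * ((a - x) * 4) = 2 * (B * ((a - x) * 2)) by ring.
by rewrite ler_pM2l.
Qed.

(* If [d = |z - x|] is smaller than [X / 2 = x (a - x) / 2], every critical point is closer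
   to [z] than to [a], by the uniform factor [1 - (X / 2 - d)]. *)
Lemma zero_free z x : z \in zs -> 0 < x < a -> x * (a - x) / 2 <= normc (z - x%:C).
Proof.
move=> zin xa; have [q0 q1 qX] := contract_factor xa.
rewrite leNgt; apply/negP => zx; set X := x * (a - x) in q0 q1 qX zx.
have Pz : P.[z] = 0.
  by apply/rootP; rewrite root_prod_XsubC inE zin orbT.
set d := normc _ in zx; have d0 : 0 <= d := normc_ge0 _.
pose q := 1 - (X / 2 - d).
have q01 : 0 <= q < 1 by rewrite /q; apply/andP; split; lra.
have ztq w : w \in zts -> normc (w - z) <= q * normc (w - a%:C).
  move=> win; have := contract win xa; rewrite -/X => h.
  have : normc (w - z) <= normc (w - x%:C) + d.
    by rewrite /d (normc_sub z) -[w - z](subrKA x%:C); apply: le_normcD.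
  have := far win; set D := normc (w - a%:C) in h * => D1 h'.
  apply: le_trans h' _; rewrite /q.
  have : 0 <= (D - 1) * d by rewrite mulr_ge0 // subr_ge0.
  have : Num.sqrt (1 - X) * D <= (1 - X / 2) * D by apply: ler_wpM2r; lra.
  lra.
(* [a] is a simple zero because [|P'(a)| >= m + 1], so it does not recur in [zs]. *)
have za : z != a%:C.
  apply/eqP => za.
  have : P^`().[a%:C] = 0.
    rewrite /P big_cons derivM derivXsubC mul1r hornerD hornerM !hornerE subrr mul0r addr0.
    by apply/rootP; rewrite root_prod_XsubC -za.
  move/(congr1 (@normc R)); rewrite normc0 => e.
  by have := normc_dP_a_ge; rewrite e leNgt ltr0Sn.
have := normc_horner_ge szts dP Pa zta za q01 ztq.
rewrite Pz normc0 mul0r leNgt mulr_gt0 //.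
  by apply: lt_le_trans normc_dP_a_ge; rewrite ltr0Sn.
rewrite mulr_gt0 ?normc_gt0 ?subr_eq0 1?eq_sym // subr_gt0.
by case/andP: q01 => ? ?; rewrite exprn_ilt1.
Qed.

Lemma pseudo_zero_free c r z : 9 / 10 * a <= c -> c < a ->
  a - c <= a * (1 - a) / 10 -> 0 < r <= 1 / 2 -> 2 * r * (1 - c ^+ 2) = c * (a - c) ->
  z \in zs -> r * normc (1 - c%:C * z) <= normc (c%:C - z).
Proof.
move=> c9 ca ac r01 rE zin; rewrite leNgt; apply/negP => lt.
have [x xa] := pseudo_disk_subset a01 c9 ca ac r01 rE lt.
by rewrite ltNge zero_free.
Qed.

Lemma sum_Re_critical :
  m.+1%:R * \sum_(w <- zts) complex.Re w = m%:R * (a + \sum_(z <- zs) complex.Re z).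
Proof.
have s1 : size (a%:C :: zs) = m.+1 by rewrite /= szs.
have ReMn k (u : R[i]) : complex.Re (k%:R * u) = k%:R * complex.Re u.
  by rewrite !mulr_natl; elim: k => [|k IH]; rewrite ?mulr0n // !mulrS ReD IH.
have := congr1 (@complex.Re R) (sum_critical s1 szts dP).
by rewrite !ReMn !Re_sum big_cons.
Qed.

Lemma reversed_critical c : 0 < c < 1 ->
  (\prod_(w <- zts) normc (1 - c%:C * w)) * (1 - c) <=
  (1 - c * a) * \prod_(z <- zs) normc (1 - c%:C * z).
Proof.
move=> c01; have s1 : size (a%:C :: zs) = m.+1 by rewrite /= szs.
have := prod_reversed_critical s1 szts dP all_zs1 c01; rewrite big_cons.
rewrite -rmorphM -(rmorph1 (real_complex R)) -rmorphB normcR ger0_norm // subr_ge0.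
by case/andP: c01 => c0 c1; rewrite mulr_ile1 // ltW.
Qed.
End NoCriticalPoint.
End ComplexPoly.

(** * Transfer from coefficient lists to polynomials over [R[i]] *)

Module Encoding.
From mathcomp Require Import all_boot all_order all_algebra.
From mathcomp Require Import complex ring Rstruct.
Set Implicit Arguments.
Unset Strict Implicit.
Unset Printing Implicit Defensive.
Import GRing.Theory Num.Theory.
Import ComplexField.Normc.
Local Open Scope ring_scope.
Local Open Scope complex_scope.
Notation R := Rdefinitions.R.

Definition toC (w : Cx) : R[i] := Complex (Cre w) (Cim w).
Definition ofC (z : R[i]) : Cx := mkC (complex.Re z) (complex.Im z).

Lemma ofCK z : toC (ofC z) = z. Proof. by case: z. Qed.
Lemma toC_inj : injective toC. Proof. by case=> ? ? [? ?] [-> ->]. Qed.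

Lemma toC_add z w : toC (Cadd z w) = toC z + toC w. Proof. by []. Qed.
Lemma toC_sub z w : toC (Csub z w) = toC z - toC w. Proof. by []. Qed.
Lemma toC_mul z w : toC (Cmul z w) = toC z * toC w. Proof. by []. Qed.
Lemma toC_RtoC x : toC (RtoC x) = x%:C. Proof. by []. Qed.

Lemma Cmod_normc w : Cmod w = normc (toC w).
Proof. by rewrite /Cmod RsqrtE RplusE !RpowE. Qed.

Definition toP (p : cpoly) : {poly R[i]} := Poly (map toC p).

Lemma toP_cons a p : toP (a :: p) = toP p * 'X + (toC a)%:P.
Proof. by rewrite /toP /= cons_poly_def. Qed.

Lemma toP_eval p z : toC (peval p z) = (toP p).[toC z].
Proof.
elim: p => [|a p IH]; first by rewrite /toP /= horner0.
by rewrite toP_cons hornerMXaddC /= toC_add toC_mul IH addrC mulrC.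
Qed.

Lemma toP_add p q : toP (padd p q) = toP p + toP q.
Proof.
have toP0 : toP [::] = 0 by [].
elim: p q => [|a p IH] q; first by rewrite toP0 add0r.
case: q => [|b q]; first by rewrite toP0 addr0.
by rewrite /= !toP_cons IH toC_add polyCD; ring.
Qed.

Lemma toP_scale c p : toP (pscale c p) = (toC c)%:P * toP p.
Proof.
elim: p => [|a p IH]; first by rewrite /toP /= mulr0.
by rewrite /= !toP_cons IH toC_mul polyCM; ring.
Qed.

Lemma toP_mul p q : toP (pmul p q) = toP p * toP q.
Proof.
elim: p => [|a p IH]; first by rewrite /toP /= mul0r.
by rewrite /= toP_add toP_cons toP_scale toP_cons IH (_ : toC C0 = 0) //; ring.
Qed.

Lemma toP_deriv_aux k p : toP (pderiv_aux k p) = toP p *+ k + 'X * (toP p)^`().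
Proof.
elim: p k => [|a p IH] k; first by rewrite /toP /= deriv0 mulr0 mul0rn addr0.
rewrite /= !toP_cons IH derivMXaddC toC_mul toC_RtoC INRE.
rewrite (rmorph_nat (real_complex R)) mulr_natl polyCMn mulrSr mulrnDl.
by rewrite mulrDl -mulrnAl; ring.
Qed.

Lemma toP_deriv p : toP (pderiv p) = (toP p)^`().
Proof.
case: p => [|a p]; first by rewrite /toP /= deriv0.
by rewrite toP_cons /= toP_deriv_aux derivMXaddC mulr1n mulrC.
Qed.

Lemma toP_lin w : toP (plin w) = 'X - (toC w)%:P.
Proof.
rewrite /plin !toP_cons /toP /= mul0r add0r (_ : toC _ = 1) // mul1r.
by rewrite -polyCN.
Qed.

Lemma toP_Ppoly a zs : toP (Ppoly a zs) = \prod_(z <- a%:C :: map toC zs) ('X - z%:P).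
Proof.
rewrite big_cons big_map; elim: zs => [|w zs IH].
  by rewrite big_nil mulr1 -toC_RtoC -toP_lin.
rewrite -[Ppoly a _]/(pmul (plin w) (Ppoly a zs)).
by rewrite big_cons toP_mul toP_lin IH; ring.
Qed.

Lemma In_mem (w : R[i]) zs : w \in map toC zs -> List.In (ofC w) zs.
Proof.
elim: zs => //= z zs IH; rewrite inE => /predU1P[->|/IH]; last by right.
by left; apply: toC_inj; rewrite ofCK.
Qed.

(** In characteristic 0 the derivative has degree exactly [m] and leading coefficient [m + 1]; it
    splits since [R[i]] is algebraically closed. *)
Lemma deriv_factor (zs : seq R[i]) m : size zs = m.+1 ->
  exists2 zts, size zts = m &
   (\prod_(z <- zs) ('X - z%:P))^`() = m.+1%:R *: \prod_(w <- zts) ('X - w%:P).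
Proof.
move=> sz; set P := \prod_(z <- zs) _.
have sP : size P = m.+2 by rewrite size_prod_XsubC sz.
have mP : P`_m.+1 = 1.
  by have /monicP := monic_prod_XsubC zs xpredT id; rewrite lead_coefE sP.
have n0 : m.+1%:R != 0 :> R[i] by rewrite pnatr_eq0.
have sdP : size P^`() = m.+1.
  apply/eqP; rewrite eqn_leq; apply/andP; split.
    by have := lt_size_deriv (_ : P != 0); rewrite sP ltnS; apply; rewrite -size_poly_gt0 sP.
  rewrite leqNgt; apply/negP => h.
  have := @nth_default _ 0 P^`() m; rewrite coef_deriv mP => /(_ h) /eqP.
  by rewrite (negPf n0).
have lP : lead_coef P^`() = m.+1%:R by rewrite lead_coefE sdP coef_deriv mP.
have [zts] := closed_field_poly_normal P^`(); rewrite lP => e.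
exists zts; last exact: e.
by move: sdP; rewrite e size_scale // size_prod_XsubC => -[].
Qed.
End Encoding.

(** * Sums and products over the roots, and the final comparison *)

Module Conclusion.
From mathcomp Require Import all_boot all_order all_algebra.
From mathcomp Require Import complex Rstruct.
From Stdlib Require Import Lra.
Import Analysis ComplexPoly Encoding.
Set Implicit Arguments.
Unset Strict Implicit.
Unset Printing Implicit Defensive.
Import Order.TTheory GRing.Theory Num.Theory.
Import ComplexField.Normc.
Delimit Scope R_scope with coqR.
Local Open Scope ring_scope.
Local Open Scope complex_scope.
Local Notation Re := complex.Re.
Local Notation Im := complex.Im.

Implicit Types (l : seq R[i]) (f g h : R[i] -> R) (z w : R[i]).

(* Wrapping the big operators makes them atoms for the arithmetic tactics on [R]. *)
Definition sumR l f : R := \sum_(z <- l) f z.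
Definition prodR l f : R := \prod_(z <- l) f z.

Lemma sumR_nil f : (sumR [::] f = 0)%coqR. Proof. exact: big_nil. Qed.
Lemma prodR_nil f : (prodR [::] f = 1)%coqR. Proof. exact: big_nil. Qed.
Lemma sumR_cons z l f : (sumR (z :: l) f = f z + sumR l f)%coqR.
Proof. exact: big_cons. Qed.
Lemma prodR_cons z l f : (prodR (z :: l) f = f z * prodR l f)%coqR.
Proof. exact: big_cons. Qed.

Lemma prodR_gt0 l f : (forall z, z \in l -> 0 < f z)%coqR -> (0 < prodR l f)%coqR.
Proof.
elim: l => [|z l IH] h; first by rewrite prodR_nil; lra.
rewrite prodR_cons; apply: Rmult_lt_0_compat; first by apply: h; rewrite mem_head.
by apply: IH => w wl; apply: h; rewrite inE wl orbT.
Qed.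

Lemma ln_prodR l f : (forall z, z \in l -> 0 < f z)%coqR ->
  ln (prodR l f) = sumR l (fun z => ln (f z)).
Proof.
elim: l => [|z l IH] h; first by rewrite prodR_nil sumR_nil ln_1.
have hl w : w \in l -> (0 < f w)%coqR by move=> wl; apply: h; rewrite inE wl orbT.
rewrite prodR_cons sumR_cons ln_mult ?IH //; first by apply: h; rewrite mem_head.
exact: prodR_gt0.
Qed.

Lemma sumR_le l f g :
  (forall z, z \in l -> f z <= g z)%coqR -> (sumR l f <= sumR l g)%coqR.
Proof.
elim: l => [|z l IH] h; first by rewrite !sumR_nil; lra.
rewrite !sumR_cons; apply: Rplus_le_compat; first by apply: h; rewrite mem_head.
by apply: IH => w wl; apply: h; rewrite inE wl orbT.
Qed.

Lemma sumR_affine l f (u v : R) :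
  (sumR l (fun z => u + v * f z) = INR (size l) * u + v * sumR l f)%coqR.
Proof.
elim: l => [|z l IH]; first by rewrite !sumR_nil /=; lra.
change (size (z :: l)) with (size l).+1.
by rewrite !sumR_cons IH S_INR; lra.
Qed.

Lemma sumR_add l f g :
  (sumR l (fun z => f z + g z) = sumR l f + sumR l g)%coqR.
Proof.
elim: l => [|z l IH]; first by rewrite !sumR_nil; lra.
by rewrite !sumR_cons IH; lra.
Qed.

(** Turns a bound on each root into one in which the roots enter the exponent only through a sum, in
    practice that of their real parts. *)
Lemma prodR_le_exp l f g h :
  (forall z, z \in l -> 0 <= f z <= g z * exp (h z))%coqR ->
  (0 <= prodR l f <= prodR l g * exp (sumR l h))%coqR.
Proof.
elim: l => [|z l IH] H.
  by rewrite !prodR_nil sumR_nil exp_0; lra.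
rewrite !prodR_cons sumR_cons exp_plus.
have [|h1 h2] := IH; first by move=> w wl; apply: H; rewrite inE wl orbT.
have [h3 h4] := H z (mem_head _ _).
split; first exact: Rmult_le_pos.
apply: Rle_trans (Rmult_le_compat _ _ _ _ h3 h1 h4 h2) _; lra.
Qed.

Lemma normc_nneg z : (0 <= normc z)%coqR.
Proof. by apply/RleP/normc_ge0. Qed.

Lemma normc_sq z : (normc z ^ 2 = Re z ^ 2 + Im z ^ 2)%coqR.
Proof. by rewrite !RpowE sqr_normcE. Qed.

Lemma normc_Rsub_sq (x : R) z :
  (normc (x%:C - z)%R ^ 2 = (x - Re z) ^ 2 + Im z ^ 2)%coqR.
Proof.
rewrite normc_sq; case: z => u v.
change ((x - u) ^ 2 + (0 + - v) ^ 2 = (x - u) ^ 2 + v ^ 2)%coqR; ring.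
Qed.

Lemma normc_1sub_sq (x : R) z :
  (normc (1 - x%:C * z)%R ^ 2 = (1 - x * Re z) ^ 2 + (x * Im z) ^ 2)%coqR.
Proof.
rewrite normc_sq; case: z => u v.
change ((1 + - (x * u - 0 * v)) ^ 2 + (0 + - (x * v + 0 * u)) ^ 2
   = (1 - x * u) ^ 2 + (x * v) ^ 2)%coqR; ring.
Qed.

Lemma normc_1sub_ge_Re (x : R) z : (1 - x * Re z <= normc (1 - x%:C * z)%R)%coqR.
Proof.
have := Re_le_normc (1 - x%:C * z); move/RleP; case: z => u v.
change (1 + - (x * u - 0 * v) <= normc (1 - x%:C * (u +i* v))%R ->
  1 - x * u <= normc (1 - x%:C * (u +i* v))%R)%coqR => h; lra.
Qed.

(* Schwarz-Pick for the disk automorphism exchanging [0] and [c]. *)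
Lemma ln_pseudo_ge (c r : R) z : (0 < c < 1)%coqR -> (0 < r < 1)%coqR ->
  (0 < normc z <= 1)%coqR -> (r * normc (1 - c%:C * z)%R <= normc (c%:C - z)%R)%coqR ->
  (0 < normc (1 - c%:C * z)%R)%coqR ->
  (ln (normc (1 - c%:C * z)%R) + harnack_exp c r * ln (normc z)
     <= ln (normc (c%:C - z)%R))%coqR.
Proof.
move=> c01 r01 [z0 z1] rz d0.
set A : R := normc (c%:C - z) in rz *; set B : R := normc (1 - c%:C * z) in rz d0 *.
have A0 : (0 < A)%coqR by nra.
pose s := (A / B)%coqR.
have AE : A = (s * B)%coqR :> R by rewrite /s; field; lra.
(* [|1 - c z|^2 - |c - z|^2 = (1 - c^2) (1 - |z|^2)]. *)
have AB : (A <= B)%coqR.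
  apply: (Rsqr_incr_0_var _ _ _ (Rlt_le _ _ d0)); rewrite !Rsqr_pow2.
  rewrite /A /B normc_Rsub_sq normc_1sub_sq; have := normc_sq z.
  have : (normc z ^ 2 <= 1)%coqR by nra.
  set u : R := Re z; set v : R := Im z => h1 h2.
  have h3 : (0 <= (1 - c ^ 2) * (1 - (u ^ 2 + v ^ 2)))%coqR.
    by apply: Rmult_le_pos; [nra | rewrite -h2; lra].
  nra.
have s01 : (r <= s <= 1)%coqR.
  by split; apply: (Rmult_le_reg_r B) => //; rewrite -AE //; lra.
have Bn0 : 1 - c%:C * z != 0 by rewrite -normc_gt0; apply/RltP.
have zle : (normc z * (1 + c * s) <= c + s)%coqR.
  apply/RleP; apply: normc_le_pseudo => //.
  - by case: c01 => ? ?; apply/andP; split; apply/RltP.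
  - have s0 : (0 <= s)%coqR by lra.
    by case: s01 => _ s1; apply/andP; split; apply/RleP.
have cs : (0 < 1 + c * s)%coqR by nra.
have : (ln (normc z) <= ln ((c + s) / (1 + c * s)))%coqR.
  apply: ln_nondecreasing => //; apply: (Rmult_le_reg_r (1 + c * s)) => //.
  by rewrite (_ : (c + s) / (1 + c * s) * (1 + c * s) = c + s)%coqR //; field; lra.
have C1 := harnack_exp_ge1 c r c01 r01.
have := harnack_le c r c01 r01 s s01; rewrite AE ln_mult //; last by lra.
by move=> h1 h2; nra.
Qed.

(** * The contradiction for large degree *)

Section LargeDegreeCore.
Variables (a : R) (m : nat) (zs zts : seq R[i]).
Hypothesis Ha : (0 < a < 1)%coqR.
Hypothesis HN : (INR m.+1 > Rmax (N1 a) (Rmax (N2 a (c_ a)) (N3 a)))%coqR.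
Hypothesis szs : size zs = m.
Hypothesis szts : size zts = m.
Hypothesis zs1 : forall z, z \in zs -> normc z <= 1.
Let P : {poly R[i]} := \prod_(z <- a%:C :: zs) ('X - z%:P).
Hypothesis dP : P^`() = m.+1%:R *: \prod_(w <- zts) ('X - w%:P).
Hypothesis far : forall w, w \in zts -> 1 < normc (w - a%:C).

Let N := INR m.+1.
Let b : R := (a / 4)%coqR.
Let c := c_ a.
Let r := r_ a.
Let D : R := normc P^`().[a%:C].
Let k : R := normc P.[b%:C].
Let Y : R := sumR zts (fun w => Re w).
Let S : R := sumR zs (fun z => Re z).
Let p : R := prodR zs (fun z => normc z).

Let NE : INR m = (N - 1)%coqR. Proof. by rewrite /N S_INR; lra. Qed.
Let N0 : (0 < N)%coqR. Proof. exact: lt_0_INR (Nat.lt_0_succ m). Qed.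
Let a01 : 0 < a < 1.
Proof. by case: Ha => ? ?; apply/andP; split; apply/RltP. Qed.
Let b0a : 0 < b < a.
Proof.
have [h1 h2] : (0 < b /\ b < a)%coqR by rewrite /b; lra.
by apply/andP; split; apply/RltP.
Qed.
Let c0a : 0 < c < a.
Proof.
have [h1 [h2 _]] := c_bounds a Ha; have h3 : (0 < c)%coqR by rewrite /c; lra.
by apply/andP; split; apply/RltP.
Qed.
Let c01 : (0 < c < 1)%coqR.
Proof. by have [h1 [h2 _]] := c_bounds a Ha; rewrite /c; lra. Qed.
Let r01 : (0 < r < 1)%coqR.
Proof. by have [h1 _] := r_bounds a Ha; rewrite /r; lra. Qed.

Let D_ge : (N <= D)%coqR.
Proof. by apply/RleP; rewrite /N INRE; apply: (normc_dP_a_ge dP far). Qed.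

Let k0 : (0 <= k)%coqR. Proof. exact: normc_nneg. Qed.

(** From [a - b = 3/4 a], [q^(m+1) <= 1/100] and [1 + q <= 2]: the constant is just below
    [3/4 * 99/100 / 2]. *)
Let k_ge : (37 / 100 * (a * D) <= k * N)%coqR.
Proof.
pose q := sqrt (1 - b * (a - b))%coqR.
have qE : q = Num.sqrt (1 - b * (a - b)) by rewrite /q RsqrtE.
have := normc_P_ge a01 szts zs1 dP far b0a qE.
rewrite -RpowE -INRE => /RleP; rewrite -/D -/k -/N.
change ((D * ((a - b) * (1 - q ^ m.+1)) <= k * (N * (1 + q)))%coqR -> (37 / 100 * (a * D) <= k * N)%coqR).
have e : (1 - b * (a - b) = 1 - 3 * a ^ 2 / 16)%coqR by rewrite /b; field.
have X0 : (0 <= 1 - 3 * a ^ 2 / 16)%coqR by nra.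
have q0 : (0 <= q)%coqR by apply: sqrt_pos.
have q2 : (q ^ 2 = 1 - 3 * a ^ 2 / 16)%coqR.
  by rewrite /q e -Rsqr_pow2 Rsqr_sqrt.
have q1 : (q <= 1)%coqR by nra.
have qn := geometric_small a N Ha HN q m.+1 (erefl _) q0 q2.
set Q := (q ^ m.+1)%coqR in qn *; have Eb : (a - b = 3 / 4 * a)%coqR by rewrite /b; lra.
rewrite Eb => h; have D0 : (0 < a * D)%coqR by have := D_ge; have := N0; nra.
have h1 : (a * D * (99 / 100) <= a * D * (1 - Q))%coqR by apply: Rmult_le_compat_l; lra.
have h2 : (k * N * (1 + q) <= k * N * 2)%coqR.
  by apply: Rmult_le_compat_l; [apply: Rmult_le_pos => //; have := N0; lra | lra].
lra.
Qed.

Let Y_le : (Y <= (N - 1) * (a / 4))%coqR.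
Proof.
pose pb := prodR zs (fun z => normc (b%:C - z)).
have kE : k = ((a - b) * pb)%coqR.
  rewrite /k /P normc_P normc_sub -rmorphB normcR gtr0_norm //.
  by rewrite subr_gt0; case/andP: b0a.
(* [D >= N] and [37/100 / (3/4) > 49/100]. *)
have pb_ge : (49 / 100 <= pb)%coqR.
  have h := k_ge; rewrite kE in h.
  have Eb : (a - b = 3 / 4 * a)%coqR by rewrite /b; lra.
  rewrite Eb in h.
  have aN : (0 < a * N)%coqR by have := N0; nra.
  have : (a * N <= a * D)%coqR by apply: Rmult_le_compat_l; [lra | exact: D_ge].
  move=> h2; apply: (Rmult_le_reg_l (a * N)) => //; lra.
(* On the unit disk [|b - z|^2 <= 1 + (b^2 - 2 b Re z)], which is at most the exponential of the
   bracket. *)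
have pb2 : (pb ^ 2 <= exp ((N - 1) * (a / 4) ^ 2 - 2 * (a / 4) * S))%coqR.
  have [|_ h] := @prodR_le_exp zs (fun z => normc (b%:C - z)%R ^ 2)%coqR (fun _ => 1%coqR)
     (fun z => b ^ 2 + (- (2 * b)) * Re z)%coqR.
    move=> z zin; split; first exact: pow2_ge_0.
    rewrite Rmult_1_l; apply: Rle_trans (exp_ineq1_le _).
    rewrite normc_Rsub_sq.
    have := normc_sq z; have := normc_nneg z; have /RleP := zs1 zin.
    rewrite -[1]/(IZR 1); set x : R := Re z; set y : R := Im z => h1 h2 h3; nra.
  rewrite sumR_affine szs NE in h.
  have e1 : prodR zs (fun _ => 1%coqR) = 1%coqR.
    by elim: (zs) => [|z l IH]; rewrite ?prodR_nil // prodR_cons IH; lra.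
  have e2 : prodR zs (fun z => normc (b%:C - z)%R ^ 2)%coqR = (pb ^ 2)%coqR.
    rewrite /pb; elim: (zs) => [|z l IH]; rewrite ?prodR_nil ?prodR_cons ?IH; lra.
  rewrite e1 e2 Rmult_1_l in h; apply: Rle_trans h _.
  by right; congr exp; rewrite /b -/S; lra.
apply: (mean_small a N Ha HN S Y pb pb2 pb_ge).
have := sum_Re_critical szs szts dP; rewrite -!INRE NE -/N.
exact.
Qed.

Let E := exp (- ((N - 1) * a ^ 2 / 16)).

(** [lens_decay] with [1 - t <= exp (- t)] bounds squared distances, so taking roots halves the
    exponent; its sum over the critical points depends only on [Y]. *)
Let dP_le x : (0 <= x <= b)%coqR -> (normc P^`().[x%:C] <= D * E)%coqR.
Proof.
move=> x0b.
have xa : 0 <= x <= a.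
  have [h1 h2] : (0 <= x /\ x <= a)%coqR by rewrite /b in x0b; lra.
  by apply/andP; split; apply/RleP.
rewrite /D !(normc_dP dP).
have [|_ h] := @prodR_le_exp zts (fun w => normc (x%:C - w)) (fun w => normc (a%:C - w))
   (fun w => (- ((a - x) * (a + x) / 8)) + ((a - x) / 4) * Re w)%coqR.
  move=> w win; split; first exact: normc_nneg.
  have [a0 a1] := andP a01.
  have := lens_decay a0 xa (ltW a1) (critical_le1 a01 zs1 dP win) (ltW (far win)).
  rewrite -!RpowE -!INRE => /RleP.
  set u : R := normc (x%:C - w); set v : R := normc (a%:C - w); set y : R := Re w.
  change ((u ^ 2 <= v ^ 2 * (1 - (a - x) * (a + x - INR 2 * y) / INR 4))%coqR ->
    (u <= v * exp (- ((a - x) * (a + x) / 8) + (a - x) / 4 * y))%coqR).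
  rewrite (_ : INR 2 = 2%coqR); last by rewrite /=; lra.
  rewrite (_ : INR 4 = 4%coqR); last by rewrite /=; lra.
  set t := (- ((a - x) * (a + x) / 8) + (a - x) / 4 * y)%coqR => h.
  have v0 : (0 <= v)%coqR := normc_nneg _.
  have e0 := exp_pos t.
  apply: Rsqr_incr_0_var; last by apply: Rmult_le_pos; lra.
  rewrite !Rsqr_pow2; apply: Rle_trans h _; rewrite Rpow_mult_distr.
  apply: Rmult_le_compat_l; first exact: pow2_ge_0.
  rewrite exp_pow; apply: Rle_trans (exp_ineq1_le _).
  by right; rewrite /t /=; field.
rewrite sumR_affine szts NE -/Y in h.
(* Once [Y] is replaced by its bound, the exponent is [- (N - 1) (a^2 + 2 x (a/2 - x)) / 16]. *)
have mono : (exp ((N - 1) * - ((a - x) * (a + x) / 8) + (a - x) / 4 * Y) <= E)%coqR.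
  apply: exp_nondecreasing; have y1 := Y_le.
  have ax : (0 <= a - x)%coqR by rewrite /b in x0b; lra.
  have y2 : ((a - x) * Y <= (a - x) * ((N - 1) * (a / 4)))%coqR by apply: Rmult_le_compat_l.
  have n1 : (0 <= N - 1)%coqR by rewrite -NE; apply: pos_INR.
  have x2 : (0 <= x * (a / 2 - x))%coqR by apply: Rmult_le_pos; rewrite /b in x0b; lra.
  have := Rmult_le_pos _ _ n1 x2; lra.
have g0 : (0 <= prodR zts (fun w => normc (a%:C - w)%R))%coqR.
  have [|h' _] := @prodR_le_exp zts (fun w => normc (a%:C - w)) (fun w => normc (a%:C - w)) (fun _ => 0%coqR).
    by move=> w _; rewrite exp_0; have := normc_nneg (a%:C - w); lra.
  exact: h'.
have h2 := Rle_trans _ _ _ h (Rmult_le_compat_l _ _ _ g0 mono).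
rewrite -INRE -/N; move: h2.
set A : R := prodR _ _; set B : R := prodR _ _ => h2.
change (N * A <= N * B * E)%coqR; have := N0; nra.
Qed.

Let p_ge : (k - a * p <= a / 4 * (D * E))%coqR.
Proof.
have [b0 _] := andP b0a.
have h : normc (P.[b%:C] - P.[0]) <= b * (D * E)%coqR.
  apply: poly_mean_value => // x /andP[x0 xb].
  by apply/RleP/dP_le; split; apply/RleP.
have p0 : normc P.[0] = (a * p)%coqR.
  rewrite /P normc_P sub0r normcN normcR gtr0_norm; last by case/andP: a01.
  by congr (_ * _); apply: eq_bigr => z _; rewrite sub0r normcN.
have := le_normcD (P.[b%:C] - P.[0]) P.[0]; rewrite subrK p0 -/k => /RleP.
move/RleP: h; set u : R := normc _.
change ((u <= b * (D * E))%coqR -> (k <= u + a * p)%coqR ->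
  (k - a * p <= a / 4 * (D * E))%coqR); rewrite /b; lra.
Qed.

Let v : R := normc P.[c%:C].

Let v_le : (v * (N * c) <= D * 4)%coqR.
Proof.
have := normc_P_le a01 szts zs1 dP far c0a; rewrite -!INRE => /RleP.
rewrite -/v -/D -/N (_ : INR 4 = 4%coqR); last by rewrite /=; lra.
exact.
Qed.

Let pv : (1 / 4 <= p /\ v <= 16 * p / a)%coqR.
Proof.
exact: (value_bounds a N D k p v E Ha N0 D_ge k0 k_ge p_ge (decay_small a N Ha HN) v_le).
Qed.

Let pseudo z : z \in zs -> (r * normc (1 - c%:C * z)%R <= normc (c%:C - z)%R)%coqR.
Proof.
have [h1 [h2 h3]] := c_bounds a Ha; have [h4 h5] := r_bounds a Ha.
move=> zin; apply/RleP; apply: (pseudo_zero_free a01 szts zs1 dP far) => //.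
- apply/RleP; rewrite -!INRE.
  change (INR 9 / INR 10 * a <= c)%coqR; rewrite /= /c; lra.
- by case/andP: c0a.
- apply/RleP; rewrite -!INRE.
  change (a - c <= a * (1 - a) / INR 10)%coqR; rewrite /= /c; lra.
- apply/andP; split; apply/RltP || apply/RleP; first by case: h4.
  rewrite -!INRE; change (r <= 1 / INR 2)%coqR; rewrite /= /r; lra.
- rewrite -!INRE -RpowE.
  change (INR 2 * r * (1 - c ^ 2) = c * (a - c))%coqR.
  by rewrite (_ : INR 2 = 2%coqR) //=; lra.
Qed.

(** Ensures that [ln |z|] is a genuine logarithm: a zero at the origin would make [p] vanish. *)
Let z_pos z : z \in zs -> (0 < normc z)%coqR.
Proof.
have [p4 _] := pv; have := normc_nneg z => -[] // z0 zin; exfalso.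
suff e : p = 0%coqR by lra.
rewrite /p /prodR; apply/eqP; rewrite prodf_seq_eq0; apply/hasP; exists z => //=.
by apply/eqP; rewrite -z0.
Qed.

Let one_sub_pos z : normc z <= 1 -> (0 < normc (1 - c%:C * z)%R)%coqR.
Proof.
move=> /RleP z1; apply: Rlt_le_trans (normc_1sub_ge_Re c z).
have /RleP h := Re_le_normc z.
have h' : (Re z <= 1)%coqR := Rle_trans _ _ _ h z1.
have c01' := c01; have := Rmult_le_compat_l c _ _ (Rlt_le _ _ (proj1 c01')) h'.
by move: h'; set y : R := Re z; lra.
Qed.

Let c_sub_pos z : z \in zs -> (0 < normc (c%:C - z)%R)%coqR.
Proof.
move=> zin; have := pseudo zin; have := one_sub_pos (zs1 zin).
set A : R := normc _; set B : R := normc _ => ? ?; have := r01; nra.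
Qed.

Let s1 := sumR zs (fun z => ln (normc (1 - c%:C * z))).

Let vE : v = ((a - c) * prodR zs (fun z => normc (c%:C - z)%R))%coqR.
Proof.
rewrite /v /P normc_P normc_sub -rmorphB normcR gtr0_norm //.
by rewrite subr_gt0; case/andP: c0a.
Qed.

Let ac_pos : (0 < a - c)%coqR.
Proof. by have [h1 [h2 h3]] := c_bounds a Ha; rewrite /c; lra. Qed.

Let v_pos : (0 < v)%coqR.
Proof.
by rewrite vE; apply: Rmult_lt_0_compat ac_pos _; apply: prodR_gt0 => z; apply: c_sub_pos.
Qed.

Let s1_le : (s1 <= ln (v / (a - c)) - harnack_exp c r * ln p)%coqR.
Proof.
have ac := ac_pos.
rewrite (_ : v / (a - c) = prodR zs (fun z => normc (c%:C - z)%R))%coqR; last first.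
  by rewrite vE; field; lra.
rewrite /p !ln_prodR; [|exact: z_pos|exact: c_sub_pos].
have -> : sumR zs (fun z => ln (normc z)) = sumR zs (fun z => 0 + 1 * ln (normc z))%coqR.
  by rewrite sumR_affine; lra.
have : (s1 + sumR zs (fun z => 0 + harnack_exp c r * ln (normc z)) <=
  sumR zs (fun z => ln (normc (c%:C - z)%R)))%coqR.
  rewrite -sumR_add; apply: sumR_le => z zin; rewrite Rplus_0_l.
  apply: (@ln_pseudo_ge c r z c01 r01 _ (pseudo zin) (one_sub_pos (zs1 zin))).
  by split; [exact: z_pos | exact/RleP/zs1].
by rewrite !sumR_affine; lra.
Qed.

(** The chord bound is affine in [Re w] with slope [- s <= 0], so its sum depends only on [Y], and
    the upper bound on [Y] puts the mean of [Re w] at most at [a/4], where [ln_K'] applies. *)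
Let chord : ((N - 1) * ln (K'_ a) <= sumR zts (fun w => ln (normc (1 - c%:C * w)%R)))%coqR.
Proof.
have := ln_K' a Ha; cbv zeta; rewrite -/c.
set L0 := ln (sqrt _); set s := Rmin _ _ => -[[_ K1] s0].
have n1 : (0 <= N - 1)%coqR by rewrite -NE; apply: pos_INR.
apply: (@Rle_trans _ ((N - 1) * (L0 + s * (a / 4)))%coqR); first exact: Rmult_le_compat_l.
apply: (@Rle_trans _ (sumR zts (fun w => (L0 + s * (a / 2)) + (- s) * Re w)%coqR)).
  rewrite sumR_affine szts NE -/Y.
  have := Rmult_le_compat_l _ _ _ s0 Y_le; lra.
apply: sumR_le => w win.
have w1 := critical_le1 a01 zs1 dP win.
have /RleP ya := lens_Re (proj1 (andP a01)) w1 (ltW (far win)).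
have wa : (1 <= normc (w - a%:C)%R)%coqR by apply/RleP/ltW/far.
have w0 := one_sub_pos w1; move/RleP: w1 => w1.
have w2 := normc_sq w; have wn := normc_nneg w.
rewrite normc_sub in wa; have := normc_Rsub_sq a w => wa2.
have hX := normc_1sub_sq c w; have hR := normc_1sub_ge_Re c w.
move: w0 wa wa2 hX hR; set X : R := normc (1 - _); set A : R := normc (a%:C - w).
set y : R := Re w in ya w2 *; set z : R := Im w in w2 *.
set W : R := normc w in w1 w2 wn *.
change (W <= 1)%coqR in w1.
rewrite -INRE in ya; change (y <= a / INR 2)%coqR in ya; rewrite /= in ya.
move=> w0 wa wa2 hX hR.
have y1 : (-1 <= y)%coqR by nra.
have := ln_above_chord a c y X Ha; cbv zeta; rewrite -/L0 -/s => h.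
have {}h : (L0 + s * (a / 2 - y) <= ln X)%coqR.
  apply: h => //; first by have [h1 [h2 _]] := c_bounds a Ha; rewrite /c; lra.
  (* [|w - a| >= 1] means [|w|^2 >= 1 - a^2 + 2 a y], which gives the affine lower bound on
     [|1 - c w|^2]. *)
  have : (0 <= c ^ 2 * (A ^ 2 - 1))%coqR.
    by apply: Rmult_le_pos; [exact: pow2_ge_0 | nra].
  rewrite hX wa2; nra.
lra.
Qed.

Lemma no_far_critical_points : False.
Proof.
have [p4 vp] := pv.
apply: (final_contradiction a N p v s1 Ha HN p4 v_pos vp s1_le).
apply: Rle_trans chord _; rewrite -/c.
have c1 : 0 < c < 1.
  by case/andP: c0a => c0 ca; case/andP: a01 => _ a1; rewrite c0 (lt_trans ca).
have /RleP := reversed_critical a01 szs szts zs1 dP c1.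
set A : R := prodR zts (fun w => normc (1 - c%:C * w)).
set B : R := prodR zs (fun z => normc (1 - c%:C * z)).
change ((A * (1 - c) <= (1 - c * a) * B)%coqR -> (sumR zts (fun w : R[i] => ln (normc (1 - c%:C * w)%R)) <=
  ln ((1 - a * c) / (1 - c)) + s1)%coqR) => h.
have A0 : (0 < A)%coqR.
  by apply: prodR_gt0 => w win; apply/one_sub_pos/(critical_le1 a01 zs1 dP win).
have B0 : (0 < B)%coqR by apply: prodR_gt0 => z /zs1; apply: one_sub_pos.
rewrite -ln_prodR; last by move=> w win; apply/one_sub_pos/(critical_le1 a01 zs1 dP win).
rewrite /s1 -ln_prodR; last by move=> z /zs1; apply: one_sub_pos.
rewrite -/A -/B.
have ca : (0 < 1 - a * c)%coqR by have := c01; nra.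
have c1' : (0 < 1 - c)%coqR by have := c01; lra.
rewrite ln_quotient //.
have := ln_nondecreasing _ _ (Rmult_lt_0_compat _ _ A0 c1') h.
by rewrite (Rmult_comm c a) !ln_mult //; lra.
Qed.
End LargeDegreeCore.

Theorem critical_point_in_disk (a : R) (n : nat) (zs : list Cx) :
  (0 < a < 1)%coqR -> (2 <= n)%coq_nat -> length zs = (n - 1)%coq_nat ->
  (forall w : Cx, List.In w zs -> Cmod w <= 1)%coqR ->
  (INR n > Rmax (N1 a) (Rmax (N2 a (c_ a)) (N3 a)))%coqR ->
  exists z : Cx, (Cmod (Csub z (RtoC a)) <= 1)%coqR /\ peval (pderiv (Ppoly a zs)) z = C0.
Proof.
case: n => [|m] ha hn hlen hz hN; first by case: (Nat.nle_succ_0 1).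
have {hn} {}hlen : size zs = m.
  rewrite -[LHS]/(length zs) hlen; exact: Nat.sub_0_r.
have hlen' : size (map toC zs) = m by rewrite size_map.
have [|zts szts dP] := @deriv_factor (a%:C :: map toC zs) m; first by rewrite /= hlen'.
(* Either some root of the derivative lies in the disk and is the witness, or all are far and the
   section above gives a contradiction. *)
have [/hasP[w win wa]|/hasPn far] := boolP (has (fun w => normc (w - a%:C) <= 1) zts).
  exists (ofC w); split.
    by apply/RleP; rewrite Cmod_normc toC_sub ofCK toC_RtoC.
  apply: toC_inj; rewrite toP_eval ofCK toP_deriv toP_Ppoly dP.
  by apply/rootP; rewrite rootE hornerZ mulf_eq0 -rootE root_prod_XsubC win orbT.
exfalso; apply: (no_far_critical_points ha hN hlen' szts _ dP) => [z zin|w win].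
  by apply/RleP; rewrite -[z]ofCK -Cmod_normc; apply/hz/In_mem.
by rewrite ltNge far.
Qed.
End Conclusion.

Theorem mainTheorem12 (a : R) (n : nat) (zs : list Cx)
  (ha : 0 < a < 1) (hn : (2 <= n)%nat) (hlen : length zs = (n - 1)%nat)
  (hz : forall w, In w zs -> Cmod w <= 1)
  (hN : INR n > Rmax (N1 a) (Rmax (N2 a (c_ a)) (N3 a))) :
  exists z : Cx, Cmod (Csub z (RtoC a)) <= 1 /\ peval (pderiv (Ppoly a zs)) z = C0.
Proof. exact (Conclusion.critical_point_in_disk ha hn hlen hz hN). Qed.
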